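(* Let $\tilde w\in\tilde W$ and let $A$ be a Weyl chamber. If $A$ is in good position with respect to $\tilde w$, then $\tilde w_A=x_A^{-1}\tilde w x_A$ is a good element and is of minimal length in its conjugacy class.
   Context: $(W,S)$ is a finite Coxeter group with simple reflections $s_i$ ($i\in S$) and length function $\ell$; $\delta:W\to W$ is a group automorphism permuting the simple reflections; $\tilde W=\langle\delta\rangle\ltimes W$, with $\ell(\delta^k w)=\ell(w)$ for $k\in\mathbb Z$, $w\in W$. $V$ is a finite-dimensional real inner product space with an injective homomorphism $\tilde W\to GL(V)$ preserving the inner product, such that each $s_i$ acts as a reflection. $\mathfrak H$ is the set of hyperplanes $H\subset V$ whose orthogonal reflection lies in $W$. A Weyl chamber is a connected component of $V-\bigcup_{H\in\mathfrak H}H$; $W$ permutes these simply transitively. The fundamental chamber $C$ is the Weyl chamber whose walls are the reflecting hyperplanes of the $s_i$, $i\in S$, and $\delta(C)=C$. For a Weyl chamber $A$, $x_A\in W$ is the unique element with $x_A(C)=A$. For a convex subset $K\subset V$, $\mathfrak H_K=\{H\in\mathfrak H: K\subset H\}$, and a point $x\in K$ is a regular point of $K$ if every $H\in\mathfrak H$ containing $x$ contains $K$. Let $\theta_1<\dots<\theta_r$ be all the elements $\theta\in[0,\pi]$ such that $e^{\sqrt{-1}\,\theta}$ is an eigenvalue of $\tilde w$ on $V\otimes_{\mathbb R}\mathbb C$; let $V^\theta_{\tilde w}=\{v\in V:\tilde w(v)+\tilde w^{-1}(v)=2\cos\theta\, v\}$ and $F_i=\sum_{j=1}^i V^{\theta_j}_{\tilde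 w}$ for $0\le i\le r$. For a Weyl chamber $A$ let $C_i$ be the connected component of $V-\bigcup_{H\in\mathfrak H_{F_i}}H$ containing $A$. $A$ is in good position with respect to $\tilde w$ if for every $0\le i<r$ the closure $\overline{C_i}$ contains a regular point of $F_{i+1}$. $B^+$ is the braid monoid associated with $(W,S)$, and $W\to B^+$, $w\mapsto\underline w$, is the canonical injection identifying the generators, with $\underline{w_1w_2}=\underline{w_1}\,\underline{w_2}$ whenever $\ell(w_1w_2)=\ell(w_1)+\ell(w_2)$. $\delta$ induces an automorphism of $B^+$; $\tilde B^+=\langle\delta\rangle\ltimes B^+$, and $\underline{\delta^k w}=\delta^k\underline w$. An element $\tilde x\in\tilde W$ of order $d$ is good if there exist a strictly decreasing sequence $S_0\supset S_1\supset\dots\supset S_l$ of subsets of $S$ and even positive integers $d_0,\dots,d_l$ such that $\underline{\tilde x}^{\,d}=\underline{w_0}^{\,d_0}\cdots\underline{w_l}^{\,d_l}$ in $\tilde B^+$, where $w_i$ is the maximal (longest) element of the parabolic subgroup of $W$ generated by $S_i$. *)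

(* Defs.v *)
From HB Require Import structures.
From mathcomp Require Import all_boot all_order all_algebra all_fingroup.
From mathcomp Require Import all_classical all_reals all_analysis.
From mathcomp Require Import sesquilinear complex.

Set Implicit Arguments.
Unset Strict Implicit.
Unset Printing Implicit Defensive.

Import Order.TTheory GRing.Theory Num.Theory.
Import numFieldNormedType.Exports.

Local Open Scope classical_set_scope.
Local Open Scope ring_scope.

Inductive congr_gen (T : Type) (r : seq T -> seq T -> Prop) :
    seq T -> seq T -> Prop :=
| CongrRel u v : r u v -> congr_gen r u v
| CongrRefl u : congr_gen r u u
| CongrSym u v : congr_gen r u v -> congr_gen r v u
| CongrTrans u v w : congr_gen r u v -> congr_gen r v w -> congr_gen r u w
| CongrCat u u' v v' :
    congr_gen r u u' -> congr_gen r v v' -> congr_gen r (u ++ v) (u' ++ v').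

Section Coxeter.

(* The elements of gT form the whole semidirect product of <delta> and W. The
   simple reflections are not indexed: S is the set of these elements of W. *)
Variables (gT : finGroupType) (W : {group gT}) (S : {set gT}) (delta : gT).
Implicit Types (s t w x : gT) (u v : seq gT).

(* The word s t s t ... with n letters. *)
Definition alt_word s t n : seq gT := mkseq (fun i => if odd i then t else s) n.

Definition word_prod u : gT := (\prod_(s <- u) s)%g.

Definition S_word u : bool := all (mem S) u.

Definition coxeter_rel u v : Prop :=
  exists s t, [/\ s \in S, t \in S,
                  u = alt_word s t (#[(s * t)%g]%g).*2 & v = [::]].

(* W has the presentation < S | (s t)^m(s,t) = 1 >, with m(s,t) the order of
   s t.  The relations s s = 1 (the case s = t) make the presented monoid a
   group, so it is the group with that presentation. *)
Definition coxeter_system : Prop :=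
  [/\ <<S>>%g = W,
      {in S, forall s, #[s]%g = 2%N} &
      forall u v, S_word u -> S_word v ->
        word_prod u = word_prod v -> congr_gen coxeter_rel u v].

(* delta acts on W by w |-> delta * w * delta^-1.  The trivial centraliser says
   that <[delta]> is faithfully a group of automorphisms of W, i.e. it is the
   subgroup of Aut W generated by the automorphism delta. *)
Definition twisted_by_delta : Prop :=
  [/\ (W ><| <[delta]>)%g = [set: gT]%SET,
      'C_(<[delta]>)(W)%g = 1%g &
      (S :^ delta)%g = S].

Definition is_expr w u : bool := S_word u && (word_prod u == w).

(* Least number of letters of an expression of w, for w in <<S>>; the search
   bound is harmless, as reduced words have fewer than #|gT| letters. *)
Definition len w : nat :=
  find (fun n => [exists u : n.-tuple gT, is_expr w u]) (iota 0 #|gT|.+1).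

(* x = delta_part x * W_part x, with delta_part x in <[delta]> and W_part x
   in W. *)
Definition delta_part x : gT := remgr W <[delta]>%g x.
Definition W_part x : gT := ((delta_part x)^-1 * x)%g.

(* The length is extended to gT so that l(delta^k w) = l(w). *)
Definition tlen x : nat := len (W_part x).

(* The maximum is attained at a unique element; 1 is only the witness that
   <<J>> is not empty. *)
Definition longest (J : {set gT}) : gT :=
  [arg max_(w > 1%g in <<J>>%g) len w]%N.

Definition braid_rel u v : Prop :=
  exists s t, [/\ s \in S, t \in S, u = alt_word s t #[(s * t)%g]%g
                & v = alt_word t s #[(s * t)%g]%g].

(* The pair (a, u), with a in <[delta]> and u an S-word, represents the element
   a * u of <delta> |>< B+; two pairs represent the same element when they are
   related by [tbraid_eq]. *)
Definition tbraid : Type := (gT * seq gT)%type.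

Definition tbraid_eq (b c : tbraid) : Prop :=
  b.1 = c.1 /\ congr_gen braid_rel b.2 c.2.

Definition tbraid1 : tbraid := (1%g, [::]).

(* a u * a' u' = (a a') * (a'^-1 u a') u' *)
Definition tbraid_mul (b c : tbraid) : tbraid :=
  ((b.1 * c.1)%g, [seq (s ^ c.1)%g | s <- b.2] ++ c.2).

Definition tbraid_exp (b : tbraid) (n : nat) : tbraid :=
  iter n (tbraid_mul b) tbraid1.

(* A reduced word for w in <<S>>.  By Matsumoto's theorem all of them represent
   the same element of B+. *)
Definition reduced_word w : seq gT :=
  if [pick u : (len w).-tuple gT | is_expr w u] is Some u then val u else [::].

Definition tbraid_lift x : tbraid := (delta_part x, reduced_word (W_part x)).

Definition good_element x : Prop :=
  exists (l : nat) (J : nat -> {set gT}) (d : nat -> nat),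
    [/\ forall i, (i <= l)%N -> J i \subset S,
        forall i, (i < l)%N -> J i.+1 \proper J i,
        forall i, (i <= l)%N -> ~~ odd (d i) && (0 < d i)%N &
        tbraid_eq (tbraid_exp (tbraid_lift x) #[x]%g)
          (\big[tbraid_mul/tbraid1]_(i < l.+1)
             tbraid_exp (tbraid_lift (longest (J i))) (d i))].

Definition min_length_in_class x : Prop :=
  forall y, y \in (x ^: [set: gT]%SET)%g -> (tlen x <= tlen y)%N.

End Coxeter.

(* An inner product ip on such a V satisfying `|v| ^+ 2 = ip v v makes V a
   finite-dimensional Euclidean space with its usual topology. *)
#[short(type="finNormedModType")]
HB.structure Definition FinNormedModule (R : realType) :=
  {V of NormedModule R V & Vector R V}.

Section Geometry.

Variables (R : realType) (V : finNormedModType R) (ip : {dot V for idfun}).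
Variables (gT : finGroupType) (rho : gT -> 'End(V)).
Implicit Types (H U : {vspace V}) (A D K : set V) (f : 'End(V)).

Definition orthogonal_rep : Prop :=
  [/\ rho 1%g = \1%VF,
      forall x y, rho (x * y)%g = (rho x \o rho y)%VF,
      injective rho &
      forall x u v, ip (rho x u) (rho x v) = ip u v].

Definition hyperplane H : Prop := (\dim H).+1 = \dim {:V}.

Definition orth_reflection H f : Prop :=
  {in H, forall v, f v = v} /\ {in orthov ip H, forall v, f v = - v}.

Definition is_reflection f : Prop :=
  exists H, hyperplane H /\ orth_reflection H f.

Definition is_component D A : Prop :=
  exists2 x, D x & A = connected_component D x.

Section Arrangement.

Variable W : {group gT}.

Definition reflecting_hyperplanes : set {vspace V} :=
  [set H | hyperplane H /\ exists2 w, w \in W & orth_reflection H (rho w)].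

Definition hyperplanes_over K : set {vspace V} :=
  [set H | reflecting_hyperplanes H /\ K `<=` [set` H]].

Definition regular_point K x : Prop :=
  K x /\ forall H, reflecting_hyperplanes H -> x \in H -> K `<=` [set` H].

Definition chamber A : Prop :=
  is_component (~` \bigcup_(H in reflecting_hyperplanes) [set` H]) A.

(* H is a wall of A when the face of A carried by H spans H. *)
Definition wall A H : Prop :=
  reflecting_hyperplanes H /\
  forall U, closure A `&` [set` H] `<=` [set` U] -> (H <= U)%VS.

Definition fundamental_chamber (S : {set gT}) (delta : gT) (C : set V) : Prop :=
  [/\ chamber C,
      forall H, wall C H <->
        hyperplane H /\ exists2 s, s \in S & orth_reflection H (rho s) &
      rho delta @` C = C].

(* f extended to the complexification of V, in a basis of V. *)
Definition complex_mx f : 'M[R[i]]_(\dim {:V}) :=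
  map_mx (real_complex R) (passmx.mxof (vbasis {:V}) (vbasis {:V}) f).

Definition eigen_angles f (theta : seq R) : Prop :=
  sorted <%R theta /\
  forall t, t \in theta <->
    0 <= t <= pi /\ eigenvalue (complex_mx f) (cos t +i* sin t)%C.

Definition angle_space (x : gT) (t : R) : {vspace V} :=
  lker (rho x + rho x^-1%g - (2 * cos t) *: \1)%VF.

Definition angle_flag (x : gT) (theta : seq R) (i : nat) : {vspace V} :=
  (\sum_(t <- take i theta) angle_space x t)%VS.

Definition good_position (x : gT) (theta : seq R) A : Prop :=
  forall i, (i < size theta)%N ->
  exists Ci : set V,
    [/\ is_component
          (~` \bigcup_(H in hyperplanes_over [set` angle_flag x theta i])
                [set` H]) Ci,
        A `<=` Ci &
        exists2 v, closure Ci v &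
          regular_point [set` angle_flag x theta i.+1] v].

End Arrangement.

End Geometry.

(* Main.v *)
(* Everything is read off the inversion sets N(x) of the elements x of
   <delta> |>< W, the sets of reflections whose hyperplane separates C from x C.
   They satisfy a cocycle identity, so that l(x) = #|N(x)|, whence the exchange
   condition, Matsumoto's theorem, and the rule that lifts to the braid monoid
   multiply when no hyperplane is crossed twice.

   Put x = x_A^-1 wt x_A, of order d. Good position gives v_i in V^theta_i such
   that, if i is minimal with V^theta_i not inside the hyperplane H of the root
   alpha > 0, then <v_i, alpha> > 0. For such an H the sign of
   <x^k C, alpha> is that of the sinusoid f(t) = <cos t v_i + sin t u_i, alpha>
   at t = k theta_i, where u_i is the quarter turn of v_i; and any choice of
   angles p_i, each a multiple of theta_i or of pi, is realized by a chamber
   whose side of H is the sign of f(p_i). With d theta_i = 2 pi m_i, the chambers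
   of the angles min (k theta_i) (pi min (j, 2 m_i)) form a grid whose unit
   squares commute in the braid monoid, since a sinusoid does not change sign
   twice on an interval of length pi. One side of the grid is the lift of x to
   the power d, the other one is the product over a of the squares of the lifts
   of the longest elements of the parabolic subgroups of the H with m_i > a.

   Comparing word lengths, d l(x) is the sum over H of 2 m_i. For a conjugate of
   x, the orbit of a chamber crosses H at least 2 m_i times, because the
   sequence <x^k c, alpha> is orthogonal to all frequencies less than theta_i
   (a discrete Sturm theorem). *)

Require Import Defs.
From HB Require Import structures.
From mathcomp Require Import all_boot all_order all_algebra all_fingroup.
From mathcomp Require Import all_classical all_reals all_analysis.
From mathcomp Require Import sesquilinear complex.
From mathcomp Require Import cyclic.
From mathcomp Require Import ring lra zify.

Set Implicit Arguments.
Unset Strict Implicit.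
Unset Printing Implicit Defensive.

Import Order.TTheory GRing.Theory Num.Theory.
Import numFieldNormedType.Exports.

#[local] Arguments S_word : simpl never.

(** * Words and Matsumoto's theorem *)

Section Words.

Import mathcomp.boot.fintype mathcomp.boot.finset.
Local Open Scope group_scope.

Variables (gT : finGroupType) (W : {group gT}) (S : {set gT}).
Implicit Types (s t w x : gT) (u v : seq gT).

Lemma word_prod_cons s u : word_prod (s :: u) = s * word_prod u.
Proof. by rewrite /word_prod big_cons. Qed.

Lemma word_prod_nil : word_prod (Nil gT) = 1.
Proof. by rewrite /word_prod big_nil. Qed.

Lemma word_prod_cat u v : word_prod (u ++ v) = word_prod u * word_prod v.
Proof. by rewrite /word_prod big_cat. Qed.

Lemma word_prodJ u x : word_prod [seq s ^ x | s <- u] = word_prod u ^ x.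
Proof.
elim: u => [|s u IHu] /=; first by rewrite word_prod_nil conj1g.
by rewrite !word_prod_cons IHu conjMg.
Qed.

Lemma S_word_cons s u : S_word S (s :: u) = (s \in S) && S_word S u.
Proof. by []. Qed.

Lemma S_word_cat u v : S_word S (u ++ v) = S_word S u && S_word S v.
Proof. exact: all_cat. Qed.

Lemma S_word_prod u : S_word S u -> word_prod u \in <<S>>.
Proof.
elim: u => [|s u IHu]; first by rewrite word_prod_nil group1.
rewrite S_word_cons word_prod_cons => /andP[sS /IHu uG].
by rewrite groupM // mem_gen.
Qed.

Lemma gen_S_word w : w \in <<S>> -> exists2 u, S_word S u & word_prod u = w.
Proof.
case/gen_prodgP=> n [c cS ->]; exists [seq c i | i <- index_enum 'I_n].
  by apply/allP=> _ /mapP[i _ ->]; apply: cS.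
by rewrite /word_prod big_map.
Qed.

(** For a word [s1 ... sn] in involutions these are the reflections
    [s1 ... s(i-1) si s(i-1) ... s1]. Multiplying the product on the left by the i-th one erases the
    i-th letter. *)
Fixpoint word_refls u : seq gT :=
  if u is s :: v then s :: [seq t ^ s | t <- word_refls v] else [::].

Lemma size_word_refls u : size (word_refls u) = size u.
Proof. by elim: u => //= s u <-; rewrite size_map. Qed.

End Words.

(** * Abstract inversion sets: length, exchange, Matsumoto's theorem *)

Section InversionSets.

Import mathcomp.boot.fintype mathcomp.boot.finset.
Local Open Scope group_scope.

Variables (gT : finGroupType) (W : {group gT}) (S : {set gT}).
(** [inv] is kept abstract until the roots are available. The cocycle rule [mem_invM] says that a
    hyperplane separates [C] from [x y C] when it separates exactly one of the pairs [C], [x C] and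
    [x C], [x y C]. *)
Variable (inv : gT -> {set gT}).
Hypothesis genS : <<S>> = W.
Hypothesis S2 : {in S, forall s, #[s] = 2%N}.
Hypothesis mem_invM :
  forall x y t, (t \in inv (x * y)) = (t \in inv x) (+) (t ^ x \in inv y).
Hypothesis inv_simple : {in S, forall s, inv s = [set s]}.
Implicit Types (s t w x y : gT) (u v : seq gT).

Lemma simpleV s : s \in S -> s^-1 = s.
Proof. by move=> /S2 s2; rewrite invg_expg s2 expg1. Qed.

Lemma simple_mulK s x : s \in S -> s * (s * x) = x.
Proof. by move=> sS; rewrite -{1}(simpleV sS) mulKg. Qed.

Lemma inv1 : inv 1 = set0.
Proof. by apply/setP=> t; have := mem_invM 1 1 t; rewrite mulg1 conjg1 inE addbb. Qed.

Lemma mem_invVM x y t :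
  (t \in inv (x^-1 * y)) = (t ^ x^-1 \in inv x) (+) (t ^ x^-1 \in inv y).
Proof.
have := mem_invM x^-1 x t; rewrite mulVg inv1 inE mem_invM.
by case: (t \in _); case: (_ \in inv x).
Qed.

Lemma card_inv_mul x y :
  #|inv (x * y)| = #|(inv x :\: (inv y :^ x^-1)) :|: ((inv y :^ x^-1) :\: inv x)|.
Proof.
apply: eq_card => t; rewrite !inE mem_invM mem_conjg invgK.
by do 2!case: (_ \in _).
Qed.

(** [inv (x * y)] is the symmetric difference of [inv x] and a conjugate of [inv y]; their
    intersection consists of the hyperplanes crossed twice. So lengths add exactly when nothing is
    crossed twice. *)
Lemma card_inv_mul_sub x y :
  #|inv (x * y)| + 2 * #|inv x :&: (inv y :^ x^-1)| = #|inv x| + #|inv y|.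
Proof.
rewrite -(cardJg (inv y) x^-1) card_inv_mul.
set A := inv x; set B := inv y :^ _; rewrite cardsU.
have -> : (A :\: B) :&: (B :\: A) = set0.
  by apply/setP=> t; rewrite !inE; do 2!case: (_ \in _).
rewrite cards0 subn0 mul2n -addnn addnACA; congr (_ + _).
  by rewrite addnC cardsID.
by rewrite addnC setIC cardsID.
Qed.

Lemma leq_card_invM x y : #|inv (x * y)| <= #|inv x| + #|inv y|.
Proof. by rewrite -card_inv_mul_sub leq_addr. Qed.

Lemma simple_inv_mul s w : s \in S -> (s \in inv (s * w)) = (s \notin inv w).
Proof. by move=> sS; rewrite mem_invM (inv_simple sS) inE eqxx conjgE mulKg. Qed.

Lemma card_inv_simple_notin s w :
  s \in S -> s \notin inv w -> #|inv (s * w)| = #|inv w|.+1.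
Proof.
move=> sS sNw; have := card_inv_mul_sub s w; rewrite (inv_simple sS) cards1 add1n.
suff -> : #|[set s] :&: inv w :^ s^-1| = 0%N by rewrite addn0.
apply/eqP; rewrite cards_eq0; apply/eqP/setP=> t.
rewrite !inE mem_conjg invgK; apply/negP=> /andP[/eqP->].
by rewrite conjgE mulKg (negPf sNw).
Qed.

Lemma card_inv_simple_in s w :
  s \in S -> s \in inv w -> #|inv w| = #|inv (s * w)|.+1.
Proof.
move=> sS sw; rewrite -{1}[w](simple_mulK _ sS) card_inv_simple_notin //.
by rewrite simple_inv_mul // negbK.
Qed.

(** This is the cocycle rule unfolded letter by letter: an inversion is a reflection crossed an odd
    number of times. *)
Lemma mem_inv_word u t :
  S_word S u -> (t \in inv (word_prod u)) = odd (count_mem t (word_refls u)).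
Proof.
elim: u t => [|s u IHu] t; first by rewrite word_prod_nil inv1 inE.
rewrite S_word_cons word_prod_cons /= => /andP[sS uS].
rewrite mem_invM (inv_simple sS) inE oddD oddb (eq_sym t) IHu //.
congr (_ (+) odd _); rewrite count_map; apply: eq_count => r /=.
apply/eqP/eqP=> [->|<-]; rewrite -conjgM -{2}(simpleV sS).
  by rewrite mulgV conjg1.
by rewrite mulgV conjg1.
Qed.

Lemma inv_word_refls u t :
  S_word S u -> t \in inv (word_prod u) -> t \in word_refls u.
Proof.
by move=> uS; rewrite mem_inv_word // -has_pred1 has_count; case: (count _ _).
Qed.

Lemma card_inv_word u : S_word S u -> #|inv (word_prod u)| <= size u.
Proof.
move=> uS; rewrite -(size_word_refls u).
apply: (leq_trans _ (card_size _)); apply: subset_leq_card; apply/subsetP=> t.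
exact: inv_word_refls.
Qed.

Lemma inv_reduced_word u t : S_word S u -> uniq (word_refls u) ->
  (t \in inv (word_prod u)) = (t \in word_refls u).
Proof. by move=> uS uU; rewrite mem_inv_word // count_uniq_mem // oddb. Qed.

Lemma exchange u t : S_word S u -> t \in word_refls u ->
  exists v, [/\ S_word S v, (size v).+1 = size u
                & word_prod u = t * word_prod v].
Proof.
elim: u t => [|s u IHu] t //.
rewrite S_word_cons /= inE => /andP[sS uS] /orP[/eqP->|/mapP[r ru ->]].
  by exists u; rewrite word_prod_cons.
have [v [vS szv uE]] := IHu r uS ru.
exists (s :: v); split=> //=; first by rewrite S_word_cons sS.
  by rewrite szv.
by rewrite !word_prod_cons uE conjgE (simpleV sS) -!mulgA simple_mulK.
Qed.

(** Induction on a word for [w]: a new first letter either adds an inversion and is kept, or is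
    already an inversion of the rest, and the exchange condition shortens the rest instead. *)
Lemma exists_reduced_word w : w \in W ->
  exists u, [/\ S_word S u, word_prod u = w & size u = #|inv w|].
Proof.
rewrite -genS => /gen_S_word[u + <-]; elim: u => [|s u IHu].
  by exists [::]; rewrite word_prod_nil inv1 cards0.
rewrite S_word_cons word_prod_cons => /andP[sS /IHu[v [vS uE szv]]].
rewrite -uE in szv *; case: (boolP (s \in inv (word_prod v))) => sv.
  have [v' [v'S szv' vE]] := exchange vS (inv_word_refls vS sv).
  exists v'; rewrite vE simple_mulK //; split=> //; apply/eq_add_S.
  by rewrite szv' szv (card_inv_simple_in sS sv) vE simple_mulK.
exists (s :: v); rewrite /= S_word_cons sS word_prod_cons.
by rewrite card_inv_simple_notin // szv.
Qed.

Lemma lenE w : w \in W -> len S w = #|inv w|.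
Proof.
move=> wW; have [u [uS uE szu]] := exists_reduced_word wW.
rewrite /len; set k := #|inv w|; set p := (fun n : nat => _).
(* The bounded search that defines [len] reaches [k]. *)
have k_lt : k < #|gT|.+1 by rewrite ltnS max_card.
rewrite -(subnKC (ltnW k_lt)) iotaD add0n find_cat size_iota.
have pk : p k.
  apply/existsP; exists (tcast szu (in_tuple u)).
  by rewrite /is_expr val_tcast /= uS uE eqxx.
case: ifP => [/hasP[n]|_].
  rewrite mem_iota /= add0n => n_lt /existsP[v /andP[vS /eqP vE]].
  by have := card_inv_word vS; rewrite vE size_tuple leqNgt n_lt.
by rewrite subSn //= pk addn0.
Qed.

Lemma reduced_wordP w : w \in W ->
  [/\ S_word S (reduced_word S w), word_prod (reduced_word S w) = w
     & size (reduced_word S w) = #|inv w|].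
Proof.
move=> wW; rewrite /reduced_word; case: pickP => [u|no_u].
  by case/andP=> uS /eqP uE; split=> //; rewrite size_tuple lenE.
have [u [uS uE szu]] := exists_reduced_word wW; rewrite -lenE // in szu.
have := no_u (tcast szu (in_tuple u)).
by rewrite /is_expr val_tcast /= uS uE eqxx.
Qed.

Lemma inv_inj1 w : w \in W -> inv w = set0 -> w = 1.
Proof.
move=> /exists_reduced_word[u [_ <- szu]] w0.
by rewrite w0 cards0 in szu; rewrite (size0nil szu) word_prod_nil.
Qed.

Lemma inv_inj w x : w \in W -> x \in W -> inv w = inv x -> w = x.
Proof.
move=> wW xW wx; apply/eqP; rewrite eq_mulVg1; apply/eqP/inv_inj1.
  by rewrite groupM ?groupV.
by apply/setP=> t; rewrite mem_invVM wx addbb inE.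
Qed.

Lemma size_alt_word s t n : size (alt_word s t n) = n.
Proof. exact: size_mkseq. Qed.

Lemma alt_wordS s t n : alt_word s t n.+1 = s :: alt_word t s n.
Proof.
rewrite /alt_word /mkseq /= (iotaDl 1 0) -map_comp; congr (_ :: _).
by apply: eq_map => i /=; case: (odd i).
Qed.

Lemma S_alt_word s t n : s \in S -> t \in S -> S_word S (alt_word s t n).
Proof.
move=> sS tS; elim: n s t sS tS => // n IHn s t sS tS.
by rewrite alt_wordS S_word_cons sS IHn.
Qed.

Lemma word_refls_alt s t n : s \in S -> t \in S ->
  word_refls (alt_word s t n) = mkseq (fun i => (s * t) ^+ i * s) n.
Proof.
move=> sS tS; elim: n s t sS tS => // n IHn s t sS tS.
rewrite alt_wordS /= IHn // /mkseq /= (iotaDl 1 0) -!map_comp expg0 mul1g.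
congr (_ :: _); apply: eq_map => i /=.
rewrite add1n conjgE (simpleV sS) mulgA; congr (_ * _).
elim: i => [|i IHi]; first by rewrite expg0 mul1g expg1.
by rewrite expgSr expgSr -IHi !mulgA.
Qed.

(** The reflections [(s t)^i s] are distinct for [i] below the order of [s t], so alternating words
    up to that length are reduced. *)
Lemma uniq_word_refls_alt s t n : s \in S -> t \in S -> n <= #[s * t] ->
  uniq (word_refls (alt_word s t n)).
Proof.
move=> sS tS n_le; rewrite word_refls_alt // map_inj_in_uniq ?iota_uniq //.
move=> i j; rewrite !mem_iota !add0n /= => i_lt j_lt /mulIg /eqP.
rewrite eq_expg_mod_order !modn_small; first by move/eqP.
  exact: leq_trans n_le.
exact: leq_trans n_le.
Qed.

Lemma card_inv_alt s t n : s \in S -> t \in S -> n <= #[s * t] ->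
  #|inv (word_prod (alt_word s t n))| = n.
Proof.
move=> sS tS n_le; have uU := uniq_word_refls_alt sS tS n_le.
have uS := S_alt_word n sS tS.
rewrite -[RHS](size_alt_word s t) -size_word_refls -(card_uniqP uU).
by apply: eq_card => r; rewrite inv_reduced_word.
Qed.

(** Cut the alternating word for [(s t)^m = 1] into two halves of [m] letters and move the second
    one to the other side; its inverse is the same word read backwards, with a first letter that
    depends on parity. *)
Lemma word_prod_alt_order s t : s \in S -> t \in S ->
  word_prod (alt_word s t #[s * t]) = word_prod (alt_word t s #[s * t]).
Proof.
move=> sS tS; set m := #[s * t].
have altr (c e : gT) k : word_prod (alt_word c e k) * (if odd k then e else c)
                  = word_prod (alt_word c e k.+1).
  rewrite /alt_word /mkseq -addn1 iotaD map_cat word_prod_cat /=.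
  by rewrite add0n word_prod_cons word_prod_nil mulg1.
have alt2 a b n : a \in S -> b \in S ->
    (word_prod (alt_word b a n))^-1 =
    if odd n then word_prod (alt_word b a n) else word_prod (alt_word a b n).
  elim: n a b => [|n IHn] a b aS bS; first by rewrite word_prod_nil invg1.
  rewrite {1}alt_wordS word_prod_cons invMg IHn // (simpleV bS) /=.
  by have := altr a b n; have := altr b a n; case: (odd n).
have pow (a b : gT) k : (a * b) ^+ k = word_prod (alt_word a b k.*2).
  elim: k => [|k IHk]; first by rewrite expg0 word_prod_nil.
  by rewrite doubleS !alt_wordS !word_prod_cons expgS IHk mulgA.
have altD (a b : gT) n k : word_prod (alt_word a b (n + k)) =
    word_prod (alt_word a b n) *
    (if odd n then word_prod (alt_word b a k) else word_prod (alt_word a b k)).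
  elim: n a b => [|n IHn] a b; first by rewrite word_prod_nil mul1g.
  by rewrite addSn !alt_wordS !word_prod_cons IHn mulgA /=; case: (odd n).
have : word_prod (alt_word s t m.*2) = 1 by rewrite -pow expg_order.
rewrite -addnn altD -/m; move/(canRL (mulgK _)); rewrite mul1g => ->.
case: ifP => om; rewrite alt2 // om //.
Qed.

(** If a reduced word of [w] begins with the alternating word [y] in [t s t ...], then the inversion
    [s] of [w] is not one of [y], so the exchange condition erases a letter after [y] when [s] is
    put in front. *)
Lemma reduced_alt_prefix w n s t : w \in W -> s \in S -> t \in S ->
  s \in inv w -> t \in inv w -> n <= #[s * t] ->
  exists u, [/\ S_word S u, word_prod (alt_word s t n ++ u) = w
               & n + size u = #|inv w|].
Proof.
move=> wW; elim: n s t => [|n IHn] s t sS tS sw tw n_le.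
  by have [u [uS uE szu]] := exists_reduced_word wW; exists u.
have ts_order : #[t * s] = #[s * t].
  by rewrite -(orderJ (t * s) t) conjgE (simpleV tS) mulgA simple_mulK.
have [|u [uS uE szu]] := IHn t s tS sS tw sw; first by rewrite ts_order ltnW.
have altS := S_alt_word n tS sS.
set y := word_prod (alt_word t s n) in uE; rewrite word_prod_cat -/y in uE.
(* [s * y] is the alternating word with one more letter, still reduced. *)
have s_notin : s \notin inv y.
  apply/negP=> s_in; have := card_inv_simple_in sS s_in.
  rewrite -word_prod_cons -alt_wordS !card_inv_alt // ?ts_order; last exact: ltnW.
  by move/eqP; rewrite ltn_eqF // leqW.
have s_in : s ^ y \in inv (word_prod u).
  by have := mem_invM y (word_prod u) s; rewrite uE sw (negPf s_notin).
have [v [vS szv vE]] := exchange uS (inv_word_refls uS s_in).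
exists v; split=> //; last by rewrite addSnnS szv.
by rewrite alt_wordS /= word_prod_cons word_prod_cat -/y -uE vE conjgE -!mulgA mulKVg.
Qed.

Lemma congr_gen_cons (T : Type) (r : seq T -> seq T -> Prop)
    (a : T) (u v : seq T) :
  congr_gen r u v -> congr_gen r (a :: u) (a :: v).
Proof. by rewrite -cat1s -(cat1s a v); apply/CongrCat/CongrRefl. Qed.

Lemma reduced_head s u : S_word S (s :: u) ->
  size (s :: u) = #|inv (word_prod (s :: u))| -> s \in inv (word_prod (s :: u)).
Proof.
rewrite S_word_cons word_prod_cons => /andP[sS uS] szu.
rewrite simple_inv_mul //; apply/negP=> /(card_inv_simple_in sS).
rewrite -szu /= => cu.
by have := card_inv_word uS; rewrite cu ltnNge leqnSn.
Qed.

(* A reduced word beginning with s t s t ... can be exchanged for one beginning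
   with t s t s ... with one more letter, until the two alternating words
   represent the same element. *)
Theorem matsumoto u v : S_word S u -> S_word S v ->
  word_prod u = word_prod v -> size u = #|inv (word_prod u)| ->
  size v = #|inv (word_prod v)| -> congr_gen (braid_rel S) u v.
Proof.
move: {2}(size u) (leqnn (size u)) => n.
elim: n u v => [|n IHn] u v.
  rewrite leqn0 => /eqP/size0nil-> _ _ <-.
  by rewrite word_prod_nil inv1 cards0 => _ /size0nil->; apply: CongrRefl.
have same_head s u' v' : size u' <= n -> S_word S (s :: u') ->
    S_word S (s :: v') -> word_prod (s :: u') = word_prod (s :: v') ->
    size (s :: u') = #|inv (word_prod (s :: u'))| ->
    size (s :: v') = #|inv (word_prod (s :: v'))| ->
    congr_gen (braid_rel S) (s :: u') (s :: v').
  rewrite !S_word_cons !word_prod_cons.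
  move=> szu' /andP[sS u'S] /andP[_ v'S] /mulgI uvE szu szv.
  have tail r : S_word S r -> size (s :: r) = #|inv (s * word_prod r)| ->
      size r = #|inv (word_prod r)|.
    move=> rS /= szr; apply/eqP; rewrite eqn_leq card_inv_word // andbT.
    rewrite -ltnS szr.
    by have := leq_card_invM s (word_prod r); rewrite (inv_simple sS) cards1.
  by apply: congr_gen_cons; apply: IHn => //; apply: tail.
case: u v => [|s u] [|t v]; rewrite ?word_prod_nil.
- by move=> *; apply: CongrRefl.
- by move=> _ _ _ <- _; rewrite inv1 cards0.
- by move=> _ _ _ ->; rewrite inv1 cards0.
move=> szn uS vS uvE szu szv.
have [sS tS] : s \in S /\ t \in S by case/andP: uS => ? _; case/andP: vS.
set w := word_prod (s :: u).
have wW : w \in W by rewrite -genS S_word_prod.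
have sw : s \in inv w by apply: reduced_head.
have tw : t \in inv w by rewrite /w uvE; apply: reduced_head; rewrite // -uvE.
have [r [rS rE szr]] := reduced_alt_prefix wW sS tS sw tw (leqnn _).
have st_gt0 : 0 < #[s * t] by [].
have altSE (a b : gT) : alt_word a b #[s * t] = a :: alt_word b a #[s * t].-1.
  by rewrite -{1}(prednK st_gt0) alt_wordS.
have rE2 : word_prod (alt_word t s #[s * t] ++ r) = w.
  by rewrite -rE !word_prod_cat word_prod_alt_order.
have szE (a b : gT) : size (alt_word a b #[s * t] ++ r) = #|inv w|.
  by rewrite size_cat size_alt_word.
apply: (@CongrTrans _ _ _ (alt_word s t #[s * t] ++ r)).
  have := szE s t; have := rE; rewrite altSE cat_cons => {}rE {}szE.
  apply: same_head => //; rewrite ?rE //.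
  by rewrite -cat_cons -altSE S_word_cat S_alt_word.
apply: (@CongrTrans _ _ _ (alt_word t s #[s * t] ++ r)).
  by apply: CongrCat (CongrRefl _ _); apply: CongrRel; exists s, t.
have := szE t s; have := rE2; rewrite altSE cat_cons => {}rE2 {}szE.
apply: same_head => //; rewrite ?rE2 //.
  by have := szE; rewrite /= /w -szu /= => -[->].
by rewrite -cat_cons -altSE S_word_cat S_alt_word.
Qed.

End InversionSets.

(** * The twisted braid monoid *)

Section TwistedBraidMonoid.

Local Open Scope group_scope.
Variable gT : finGroupType.
Implicit Types b c e : tbraid gT.

Lemma tbraid_mulA : associative (@tbraid_mul gT).
Proof.
move=> [a u] [b v] [c w]; rewrite /tbraid_mul /= mulgA catA map_cat -map_comp.
by congr (_, (_ ++ _) ++ _); apply: eq_map => s /=; rewrite conjgM.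
Qed.

Lemma tbraid_mul1b : left_id (@tbraid1 gT) (@tbraid_mul gT).
Proof. by case=> a u; rewrite /tbraid_mul /= mul1g. Qed.

Lemma tbraid_mulb1 : right_id (@tbraid1 gT) (@tbraid_mul gT).
Proof.
case=> a u; rewrite /tbraid_mul /= mulg1 cats0; congr (_, _).
by under eq_map => s do rewrite conjg1; rewrite map_id.
Qed.

HB.instance Definition _ := Monoid.isLaw.Build (tbraid gT) (@tbraid1 gT)
  (@tbraid_mul gT) tbraid_mulA tbraid_mul1b tbraid_mulb1.

Lemma tbraid_expD b m n :
  tbraid_exp b (m + n) = tbraid_mul (tbraid_exp b m) (tbraid_exp b n).
Proof.
elim: m => [|m IHm]; first by rewrite tbraid_mul1b.
by rewrite addSn /tbraid_exp !iterS -/(tbraid_exp b _) IHm tbraid_mulA.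
Qed.

Lemma tbraid_exp_big b n :
  tbraid_exp b n = \big[@tbraid_mul gT/@tbraid1 gT]_(i < n) b.
Proof.
elim: n => [|n IHn]; first by rewrite big_ord0.
by rewrite big_ord_recl -IHn.
Qed.

End TwistedBraidMonoid.

(** * Lifts to the twisted braid monoid *)

Section Twisted.

Import mathcomp.boot.fintype mathcomp.boot.finset.
Local Open Scope group_scope.

Variables (gT : finGroupType) (W : {group gT}) (S : {set gT}) (delta : gT).
Variable (inv : gT -> {set gT}).
Hypothesis genS : <<S>> = W.
Hypothesis S2 : {in S, forall s, #[s] = 2%N}.
Hypothesis twist : twisted_by_delta W S delta.
Hypothesis mem_invM :
  forall x y t, (t \in inv (x * y)) = (t \in inv x) (+) (t ^ x \in inv y).
Hypothesis inv_simple : {in S, forall s, inv s = [set s]}.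
Hypothesis inv_delta : inv delta = set0.
Implicit Types (s t w x y z a : gT) (u v : seq gT) (b c e : tbraid gT).

Local Notation lift := (tbraid_lift W S delta).
Local Notation "b =B c" := (tbraid_eq S b c) (at level 70).

Lemma inv_cycle a : a \in <[delta]> -> inv a = set0.
Proof.
move=> /cycleP[k ->]; elim: k => [|k IHk]; first by rewrite (inv1 mem_invM).
by apply/setP=> t; rewrite expgS mem_invM inv_delta IHk !inE.
Qed.

Lemma cycle_normS a s : a \in <[delta]> -> s \in S -> s ^ a \in S.
Proof.
case: twist => _ _ Sd /cycleP[k ->] sS.
elim: k => [|k IHk]; first by rewrite conjg1.
by rewrite expgSr conjgM -Sd memJ_conjg.
Qed.

Lemma S_wordJ a u : a \in <[delta]> -> S_word S u ->
  S_word S [seq s ^ a | s <- u].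
Proof.
rewrite /S_word => ad /allP uS; apply/allP=> _ /mapP[s su ->].
exact: cycle_normS (uS s su).
Qed.

Lemma delta_part_in x : delta_part W delta x \in <[delta]>.
Proof.
case: twist => /sdprodP[_ defG _ _] _ _; apply: mem_remgr.
by rewrite defG inE.
Qed.

Lemma W_part_in x : W_part W delta x \in W.
Proof.
case: twist => /sdprodP[_ defG nWd _] _ _.
have xG : x \in W * <[delta]> by rewrite defG inE.
rewrite /W_part /delta_part; set r := remgr _ _ x.
have -> : r^-1 * x = divgr W <[delta]> x ^ r.
  by rewrite conjgE {3}/r -divgr_eq.
by rewrite memJ_norm ?mem_divgr // (subsetP nWd) // mem_remgr.
Qed.

Lemma delta_W_part x : delta_part W delta x * W_part W delta x = x.
Proof. by rewrite /W_part mulKVg. Qed.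

Lemma delta_partM a w : a \in <[delta]> -> w \in W ->
  delta_part W delta (a * w) = a.
Proof.
case: twist => /sdprodP[_ defG nWd tiW] _ _ ad wW.
by rewrite /delta_part conjgCV remgrMid // memJ_norm // groupV (subsetP nWd).
Qed.

Lemma W_partM a w : a \in <[delta]> -> w \in W ->
  W_part W delta (a * w) = w.
Proof. by move=> ad wW; rewrite /W_part delta_partM // mulKg. Qed.

Lemma card_inv_cycleM a w : a \in <[delta]> -> #|inv (a * w)| = #|inv w|.
Proof.
move=> /inv_cycle a0; have := card_inv_mul_sub mem_invM a w.
by rewrite a0 set0I cards0 muln0 addn0.
Qed.

Lemma tlenE x : tlen W S delta x = #|inv x|.
Proof.
rewrite /tlen (lenE genS S2 mem_invM inv_simple) ?W_part_in //.
by rewrite -(card_inv_cycleM _ (delta_part_in x)) delta_W_part.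
Qed.

Lemma tbraid_lift_W w : w \in W -> lift w = (1, reduced_word S w).
Proof.
move=> wW; have := delta_partM (group1 _) wW; have := W_partM (group1 _) wW.
by rewrite mul1g /tbraid_lift => -> ->.
Qed.

Lemma size_lift x : size (lift x).2 = #|inv x|.
Proof.
have [_ _ ->] := reduced_wordP genS S2 mem_invM inv_simple (W_part_in x).
by rewrite -(card_inv_cycleM _ (delta_part_in x)) delta_W_part.
Qed.

Lemma tbraid_eq_refl b : b =B b.
Proof. by split=> //; apply: CongrRefl. Qed.

Lemma tbraid_eq_sym b c : b =B c -> c =B b.
Proof. by case=> bc1 bc2; split=> //; apply: CongrSym. Qed.

Lemma tbraid_eq_trans c b e : b =B c -> c =B e -> b =B e.
Proof. by case=> e1 bc [e2 ce]; split; [rewrite e1|apply: CongrTrans ce]. Qed.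

Lemma congr_gen_size u v : congr_gen (braid_rel S) u v -> size u = size v.
Proof.
elim=> // [{}u {}v [s [t [_ _ -> ->]]]||]; first by rewrite !size_alt_word.
  by move=> ? ? ? _ -> _ ->.
by move=> ? ? ? ? _ szu _ szv; rewrite !size_cat szu szv.
Qed.

Lemma tbraid_eq_size b c : b =B c -> size b.2 = size c.2.
Proof. by case=> _ /congr_gen_size. Qed.

Lemma congr_genJ a u v : a \in <[delta]> -> congr_gen (braid_rel S) u v ->
  congr_gen (braid_rel S) [seq s ^ a | s <- u] [seq s ^ a | s <- v].
Proof.
move=> ad; elim=> [{}u {}v [s [t [sS tS -> ->]]]||||].
- apply: CongrRel; exists (s ^ a), (t ^ a).
  split; rewrite ?cycle_normS // -conjMg orderJ /alt_word /mkseq -map_comp;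
    by apply: eq_map => i /=; case: (odd i).
- by move=> ?; apply: CongrRefl.
- by move=> ? ? _; apply: CongrSym.
- by move=> ? ? ? _ ? _; apply: CongrTrans.
- by move=> ? ? ? ? _ ? _ ?; rewrite !map_cat; apply: CongrCat.
Qed.

Lemma tbraid_eq_mul b b' c c' : c.1 \in <[delta]> -> b =B b' -> c =B c' ->
  tbraid_mul b c =B tbraid_mul b' c'.
Proof.
move=> cd [b1 b2] [c1 c2]; split; rewrite /= ?b1 ?c1 //.
by apply: CongrCat => //; apply: congr_genJ => //; rewrite -c1.
Qed.

(** When lengths add, the concatenation of the twisted reduced word of [x] with that of [y] is
    reduced, and Matsumoto's theorem compares it with the chosen reduced word of [x * y]. *)
Lemma lift_mul x y : #|inv (x * y)| = #|inv x| + #|inv y| ->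
  tbraid_mul (lift x) (lift y) =B lift (x * y).
Proof.
move=> cxy; have redP := reduced_wordP genS S2 mem_invM inv_simple.
set a := delta_part W delta x; set w := W_part W delta x.
set c := delta_part W delta y; set v := W_part W delta y.
have [ad wW cd vW] : [/\ a \in <[delta]>, w \in W, c \in <[delta]> & v \in W].
  by split; rewrite ?delta_part_in ?W_part_in.
have wcW : w ^ c \in W.
  by case: twist => /sdprodP[_ _ nWd _] _ _; rewrite memJ_norm // (subsetP nWd).
have xyE : x * y = (a * c) * (w ^ c * v).
  have xE : x = a * w by rewrite delta_W_part.
  have yE : y = c * v by rewrite delta_W_part.
  rewrite {1}xE {1}yE; move: (a) (w) (c) (v) => p q r o.
  by rewrite conjgE !mulgA mulgK.
have acd : a * c \in <[delta]> by rewrite groupM.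
have wcvW : w ^ c * v \in W by rewrite groupM.
rewrite /tbraid_lift xyE delta_partM ?W_partM //.
split; rewrite //= -/w -/v -/c.
have [w1 w2 w3] := redP _ wW; have [v1 v2 v3] := redP _ vW.
have [p1 p2 p3] := redP _ (groupM wcW vW).
apply: (matsumoto genS S2 mem_invM inv_simple) => //.
- by rewrite S_word_cat S_wordJ.
- by rewrite p2 word_prod_cat word_prodJ w2 v2.
- rewrite size_cat size_map word_prod_cat word_prodJ w2 v2 w3 v3.
  rewrite -(card_inv_cycleM (w ^ c * v) acd) -xyE cxy.
  rewrite -(card_inv_cycleM w ad) -(card_inv_cycleM v cd).
  by rewrite !delta_W_part.
- by rewrite p2.
Qed.

(** The hypothesis says that no hyperplane is crossed twice on the way from [x C] through [y C] to
    [z C]. *)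
Lemma card_inv_sum (x y z : gT) :
  (forall t, ~~ (((t \in inv x) (+) (t \in inv y))
             && ((t \in inv y) (+) (t \in inv z)))) ->
  #|inv (x^-1 * z)| = #|inv (x^-1 * y)| + #|inv (y^-1 * z)|.
Proof.
move=> btw; have := card_inv_mul_sub mem_invM (x^-1 * y) (y^-1 * z).
rewrite mulgA mulgK => <-; rewrite [X in (2 * X)%N]eq_card0 ?addn0 // => t.
rewrite inE mem_conjg invgK !(mem_invVM mem_invM) -conjgM mulgK.
exact/negbTE/btw.
Qed.

(** The braid of the path of chambers [h 0 C], ..., [h n C]. *)
Definition chain (h : nat -> gT) n : tbraid gT :=
  \big[@tbraid_mul gT/@tbraid1 gT]_(i < n) lift ((h i)^-1 * h i.+1).

Lemma chain1_cycle h n : (chain h n).1 \in <[delta]>.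
Proof.
rewrite /chain; elim: n => [|n IHn]; first by rewrite big_ord0 group1.
by rewrite big_ord_recr /= groupM ?delta_part_in.
Qed.

(** By [lift_mul] both ways around a unit square give the lift of its diagonal. Squares are pushed
    across one row ([row]), then row after row. *)
Lemma grid_chain (g : nat -> nat -> gT) m n :
  (forall i j, (i < m)%N -> (j < n)%N ->
     let sq := (g i j)^-1 * g i.+1 j.+1 in
     [/\ #|inv sq| = #|inv ((g i j)^-1 * g i j.+1)|
                     + #|inv ((g i j.+1)^-1 * g i.+1 j.+1)|
       & #|inv sq| = #|inv ((g i j)^-1 * g i.+1 j)|
                     + #|inv ((g i.+1 j)^-1 * g i.+1 j.+1)|]) ->
  tbraid_mul (chain (fun i => g i 0%N) m) (chain (g m) n) =B
  tbraid_mul (chain (g 0%N) n) (chain (fun i => g i n) m).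
Proof.
move=> sq.
have row i k : (i < m)%N -> (k <= n)%N ->
    tbraid_mul (lift ((g i 0%N)^-1 * g i.+1 0%N)) (chain (g i.+1) k) =B
    tbraid_mul (chain (g i) k) (lift ((g i k)^-1 * g i.+1 k)).
  move=> i_m; elim: k => [|k IHk] k_n.
    rewrite /chain !big_ord0 tbraid_mulb1 tbraid_mul1b; exact: tbraid_eq_refl.
  rewrite /chain !big_ord_recr /= -!/(chain _ _) tbraid_mulA.
  have [sq1 sq2] := sq i k i_m k_n.
  apply: (@tbraid_eq_trans (tbraid_mul
      (tbraid_mul (chain (g i) k) (lift ((g i k)^-1 * g i.+1 k)))
      (lift ((g i.+1 k)^-1 * g i.+1 k.+1)))).
    apply: tbraid_eq_mul; last exact: tbraid_eq_refl.
      exact: delta_part_in.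
    exact: IHk (ltnW k_n).
  have sqE y : (g i k)^-1 * y * (y^-1 * g i.+1 k.+1) = (g i k)^-1 * g i.+1 k.+1.
    by rewrite mulgA mulgK.
  rewrite -!tbraid_mulA; apply: tbraid_eq_mul (tbraid_eq_refl _) _.
    by rewrite /= groupM ?delta_part_in.
  apply: (@tbraid_eq_trans (lift ((g i k)^-1 * g i.+1 k.+1))).
    by rewrite -(sqE (g i.+1 k)); apply: lift_mul; rewrite sqE.
  apply: tbraid_eq_sym.
  by rewrite -(sqE (g i k.+1)); apply: lift_mul; rewrite sqE.
have : (m <= m)%N by [].
move: {1 3 4 5}m => k; elim: k => [|k IHk] k_m.
  rewrite /chain !big_ord0 tbraid_mulb1 tbraid_mul1b; exact: tbraid_eq_refl.
rewrite /chain !big_ord_recr /= -!/(chain _ _).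
rewrite -[tbraid_mul (tbraid_mul _ _) _]tbraid_mulA.
apply: (@tbraid_eq_trans (tbraid_mul (chain (fun i => g i 0%N) k)
  (tbraid_mul (chain (g k) n) (lift ((g k n)^-1 * g k.+1 n))))).
  apply: tbraid_eq_mul; [|exact: tbraid_eq_refl|exact: row].
  by rewrite /= groupM ?delta_part_in ?chain1_cycle.
rewrite !tbraid_mulA; apply: tbraid_eq_mul => //; first exact: delta_part_in.
  exact: IHk (ltnW k_m).
exact: tbraid_eq_refl.
Qed.


(** * Longest elements of parabolic subgroups *)

Section Parabolic.

(** [Z] stands for the set of reflections of a parabolic subgroup, given by its hyperplanes rather
    than by generators. *)
Variables (Z : {set gT}) (z : gT).
Hypothesis zW : z \in W.
Hypothesis inv_z : inv z = Z.
Hypothesis Z_stable : forall s t, s \in S :&: Z -> t \in Z -> t ^ s \in Z.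
Hypothesis inv_par : forall w, w \in <<S :&: Z>> -> inv w \subset Z.

(** The first letter of a reduced word of [w] is an inversion, hence in [Z]; by [Z_stable], removing
    it leaves the inversions in [Z], and the length drops. *)
Lemma inv_sub_parabolic w : w \in W -> inv w \subset Z -> w \in <<S :&: Z>>.
Proof.
move: {2}(#|inv w|) (leqnn #|inv w|) => n.
elim: n w => [|n IHn] w.
  rewrite leqn0 cards_eq0 => /eqP w0 wW _.
  by rewrite (inv_inj1 genS S2 mem_invM inv_simple wW w0) group1.
move=> w_n wW wZ.
have [u [uS uE szu]] := exists_reduced_word genS S2 mem_invM inv_simple wW.
case: u => [|s u] in uS uE szu *; first by rewrite -uE word_prod_nil group1.
have sw : s \in inv w.
  rewrite -uE; apply: (reduced_head S2 mem_invM inv_simple) => //.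
  by rewrite szu uE.
have sS : s \in S by case/andP: uS.
have sJ : s \in S :&: Z by rewrite inE sS (subsetP wZ).
rewrite -(simple_mulK S2 w sS); apply: groupM; first exact: mem_gen.
apply: IHn.
- by rewrite -ltnS -(card_inv_simple_in S2 mem_invM inv_simple sS sw).
- by rewrite groupM // -genS mem_gen.
apply/subsetP=> t; rewrite mem_invM (inv_simple sS) inE.
case: eqP => [->|_ /= /(subsetP wZ) tZ]; first by rewrite (subsetP wZ).
have := Z_stable sJ tZ.
by rewrite -conjgM -{2}(simpleV S2 sS) mulgV conjg1.
Qed.

(** No element of the subgroup has inversions outside [Z], and [z] has all of [Z]; an element of
    maximal length thus has the inversion set of [z]. *)
Lemma longest_parabolic : longest S (S :&: Z) = z.
Proof.
have gW w : w \in <<S :&: Z>> -> w \in W.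
  by rewrite -genS; apply/subsetP/fingroup.genS/subsetIl.
have zJ : z \in <<S :&: Z>> by apply: inv_sub_parabolic; rewrite ?inv_z.
rewrite /longest; case: arg_maxnP => [|w wJ /(_ z zJ)]; first exact: group1.
rewrite /= !(lenE genS S2 mem_invM inv_simple) ?gW // inv_z => le_zw.
apply: (inv_inj genS S2 mem_invM inv_simple) => //; first exact: gW.
by rewrite inv_z; apply/eqP; rewrite eqEcard inv_par.
Qed.

(** The inversions of [z^-1] lie in [Z] and are as many as those of [z], being conjugate to them. *)
Lemma parabolic_involution : z^-1 = z.
Proof.
apply: (inv_inj genS S2 mem_invM inv_simple) => //; first by rewrite groupV.
rewrite inv_z; apply/eqP; rewrite eqEcard inv_par ?groupV /=; last first.
  by apply: inv_sub_parabolic; rewrite ?inv_z.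
rewrite -inv_z -(cardJg (inv z) z); apply: subset_leq_card.
apply/subsetP=> t; rewrite mem_conjg => tz.
by have := mem_invVM mem_invM z 1 t; rewrite mulg1 tz (inv1 mem_invM) inE.
Qed.

End Parabolic.

End Twisted.

(** Equal consecutive sets are merged by adding their even exponents. The clause [K 0 = J 0] lets
    the induction compare a new first set with the first one already compressed. *)
Lemma compress_longest (gT : finGroupType) (W : {group gT}) (S : {set gT})
    (delta : gT) (J : nat -> {set gT}) n :
  (forall i, J i.+1 \subset J i) ->
  exists (l : nat) (K : nat -> {set gT}) (d : nat -> nat),
    [/\ K 0%N = J 0%N, forall i, exists a, K i = J a,
        forall i, (i < l)%N -> K i.+1 \proper K i,
        forall i, (i <= l)%N -> ~~ odd (d i) && (0 < d i)%N &
        \big[@tbraid_mul gT/@tbraid1 gT]_(i < n.+1)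
          tbraid_exp (tbraid_lift W S delta (longest S (J i))) 2 =
        \big[@tbraid_mul gT/@tbraid1 gT]_(i < l.+1)
          tbraid_exp (tbraid_lift W S delta (longest S (K i))) (d i)].
Proof.
elim: n J => [|n IHn] J subJ.
  by exists 0%N, J, (fun=> 2%N); rewrite !big_ord_recl !big_ord0; split=> // i; exists i.
have [l [K [d [K0 KJ Kproper d_even bigE]]]] :=
  IHn (fun i => J i.+1) (fun i => subJ i.+1).
rewrite big_ord_recl [X in tbraid_mul _ X]bigE.
have [J01|J01] := eqVneq (J 1%N) (J 0%N).
  exists l, K, (fun i => if i is 0%N then (2 + d 0)%N else d i).
  split=> //; first by rewrite K0.
  - by move=> i; have [a ->] := KJ i; exists a.+1.
  - case=> [|i] i_l; last exact: d_even.
    by case/andP: (d_even 0%N i_l) => /negPf odd0 _; rewrite oddD odd0.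
  by rewrite !big_ord_recl tbraid_expD K0 J01 tbraid_mulA.
exists l.+1, (fun i => if i is j.+1 then K j else J 0%N).
exists (fun i => if i is j.+1 then d j else 2%N).
split=> //.
- by case=> [|i]; [exists 0%N | have [a ->] := KJ i; exists a.+1].
- case=> [|i] i_l; last exact: Kproper.
  by rewrite K0 finset.properEneq J01 subJ.
- by case=> [|i] i_l; last exact: d_even.
by rewrite [RHS]big_ord_recl.
Qed.

(** * Sinusoids and sign changes *)

Section Sinusoids.

Local Open Scope ring_scope.
Variable R : realType.
Implicit Types (x y A B p q s t phi : R).

Lemma cos2pi_nat (n : nat) x : cos (x + n%:R * (2 * pi)) = cos x.
Proof.
have -> : n%:R * (2 * pi) = (pi *+ 2 : R) *+ n.
  by rewrite -[in RHS]mulr_natl -[in RHS](mulr_natl pi).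
exact: (periodicn (@cosD2pi R)).
Qed.

Lemma sin2pi_nat (n : nat) x : sin (x + n%:R * (2 * pi)) = sin x.
Proof.
have -> : n%:R * (2 * pi) = (pi *+ 2 : R) *+ n.
  by rewrite -[in RHS]mulr_natl -[in RHS](mulr_natl pi).
exact: (periodicn (@sinD2pi R)).
Qed.

(** Modulo [2 pi], a nonzero remainder [y] has [sin (y / 2) > 0], while
    [cos y = 1 - 2 sin^2 (y / 2)]. *)
Lemma cos_eq1 x : 0 <= x -> cos x = 1 -> exists m : nat, x = m%:R * (2 * pi).
Proof.
move=> x0 cx; have pi2 : 0 < 2 * pi :> R by rewrite mulr_gt0 ?pi_gt0.
pose m := Num.truncn (x / (2 * pi)); exists m.
have /andP[] := Num.Theory.truncn_itv (divr_ge0 x0 (ltW pi2)); rewrite -/m.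
rewrite ler_pdivlMr // ltr_pdivrMr // => mx xm.
pose y := x - m%:R * (2 * pi).
have xE : x = y + m%:R * (2 * pi) by rewrite subrK.
have y0 : 0 <= y by rewrite subr_ge0.
have y2 : y < 2 * pi by rewrite ltrBlDl -natr1 mulrDl mul1r in xm *.
rewrite xE cos2pi_nat in cx.
have [y00|yn0] := eqVneq y 0; first by rewrite xE y00 add0r.
have : 0 < sin (y / 2).
  have y00 : 0 < y by rewrite lt_def yn0.
  by apply: sin_gt0_pi; apply/andP; split; lra.
have := cosD (y / 2) (y / 2); rewrite -splitr cx.
have := cos2Dsin2 (y / 2); rewrite !expr2 => cs1 cs2 s0.
have : sin (y / 2) ^+ 2 = 0 by rewrite expr2; lra.
by move/eqP; rewrite sqrf_eq0 gt_eqF.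
Qed.

Definition sinusoid A B t : R := A * cos t + B * sin t.

Lemma sinusoidDpi A B t : sinusoid A B (t + pi) = - sinusoid A B t.
Proof. by rewrite /sinusoid cosDpi sinDpi !mulrN opprD. Qed.

Lemma sinusoid_npi A B (n : nat) :
  sinusoid A B (n%:R * pi) = if odd n then - A else A.
Proof.
elim: n => [|n IHn]; first by rewrite /sinusoid mul0r cos0 sin0 mulr0 addr0 mulr1.
rewrite -natr1 mulrDl mul1r sinusoidDpi IHn /=.
by case: (odd n); rewrite ?opprK.
Qed.

(** If [s < p + pi], the identity [key] makes the middle value a combination of the outer ones with
    positive coefficients, so it shares their sign when they agree. If [s = p + pi], the outer
    values are opposite. *)
Lemma sinusoid_no_return A B p q s : p <= q -> q <= s -> s <= p + pi ->
  sinusoid A B p != 0 -> sinusoid A B q != 0 -> sinusoid A B s != 0 ->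
  ~~ (((sinusoid A B p < 0) (+) (sinusoid A B q < 0)) &&
      ((sinusoid A B q < 0) (+) (sinusoid A B s < 0))).
Proof.
move=> pq qs; rewrite le_eqVlt => /orP[/eqP->|sp].
  rewrite sinusoidDpi oppr_lt0 [0 < _]lt_def oppr_eq0 => -> q0 _ /=.
  rewrite leNgt; by do 2!case: (_ < 0).
have key : sinusoid A B q * sin (s - p)
         = sinusoid A B p * sin (s - q) + sinusoid A B s * sin (q - p).
  by rewrite /sinusoid !sinB; ring.
have [->|nqp] := eqVneq p q; first by rewrite addbb.
have [->|nqs] := eqVneq q s; first by rewrite addbb andbF.
have pltq : p < q by rewrite lt_neqAle nqp.
have qlts : q < s by rewrite lt_neqAle nqs.
have s1 : 0 < sin (s - p) by apply: sin_gt0_pi; apply/andP; split; lra.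
have s2 : 0 < sin (s - q) by apply: sin_gt0_pi; apply/andP; split; lra.
have s3 : 0 < sin (q - p) by apply: sin_gt0_pi; apply/andP; split; lra.
move: (sinusoid A B p) (sinusoid A B q) (sinusoid A B s) key => fp fq fs key.
case: (ltrgt0P fp) => // fp0; case: (ltrgt0P fs) => // fs0;
  case: (ltrgt0P fq) => // fq0; exfalso.
  have := mulr_gt0 fp0 s2; have := mulr_gt0 fs0 s3.
  by have := mulr_gt0 (_ : 0 < - fq) s1; rewrite oppr_gt0 => /(_ fq0); lra.
have := mulr_gt0 (_ : 0 < - fp) s2; rewrite oppr_gt0 => /(_ fp0).
have := mulr_gt0 (_ : 0 < - fs) s3; rewrite oppr_gt0 => /(_ fs0).
by have := mulr_gt0 fq0 s1; lra.
Qed.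

(** The sum telescopes after multiplication by [2 sin (a / 2)], which is nonzero since
    [0 < a < 2 pi]. *)
Lemma sum_cos_period (d k : nat) : (0 < k < d)%N ->
  \sum_(l < d) cos (l%:R * (k%:R * (2 * pi) / d%:R)) = 0 :> R.
Proof.
case/andP=> k0 kd; set a := k%:R * _ / _.
have d0 : 0 < d%:R :> R by rewrite ltr0n (ltn_trans k0).
have sa : 0 < sin (a / 2).
  apply: sin_gt0_pi; rewrite /a; apply/andP; split.
    by rewrite !divr_gt0 // mulr_gt0 ?ltr0n // mulr_gt0 // pi_gt0.
  have -> : k%:R * (2 * pi) / d%:R / 2 = pi * (k%:R / d%:R) :> R by field; lra.
  by rewrite gtr_pMr ?pi_gt0 // ltr_pdivrMr // mul1r ltr_nat.
have tele n : \sum_(l < n) cos (l%:R * a) * (2 * sin (a / 2)) =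
    sin (n%:R * a - a / 2) + sin (a / 2).
  elim: n => [|n IHn]; first by rewrite big_ord0 mul0r sub0r sinN addNr.
  rewrite big_ord_recr /= IHn.
  have -> : n.+1%:R * a - a / 2 = n%:R * a + a / 2 by rewrite -natr1; field.
  by rewrite sinB sinD; ring.
have := tele d; rewrite -mulr_suml.
have -> : d%:R * a - a / 2 = - (a / 2) + k%:R * (2 * pi) by rewrite /a; field; lra.
rewrite sin2pi_nat sinN addNr => /eqP; rewrite mulf_eq0 => /orP[/eqP//|].
by rewrite mulf_eq0 gt_eqF // gt_eqF.
Qed.

Lemma prod_lt0 (I : eqType) (r : seq I) (F : I -> R) :
  {in r, forall i, F i != 0} ->
  (\prod_(i <- r) F i != 0) /\
  (\prod_(i <- r) F i < 0) = odd (count (fun i => F i < 0) r).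
Proof.
elim: r => [|i r IHr] F0; first by rewrite big_nil oner_neq0 ltr10.
have [|r0 rE] := IHr; first by move=> j jr; apply: F0; rewrite inE jr orbT.
have i0 : F i != 0 by apply: F0; rewrite mem_head.
rewrite big_cons mulf_neq0 //=; split=> //.
rewrite oddD oddb -rE.
case: (ltrgt0P (F i)) i0 => // iF _ /=; first by rewrite pmulr_rlt0.
by rewrite nmulr_rlt0 // lt_def r0 leNgt.
Qed.

Lemma sum_ord_gt0 (n : nat) (F : nat -> R) : (0 < n)%N ->
  (forall k, (k < n)%N -> 0 < F k) -> 0 < \sum_(k < n) F k.
Proof.
case: n => // n _ F0; rewrite big_ord_recr /= ltr_wpDl ?F0 //.
by apply: sumr_ge0 => k _; rewrite ltW // F0 // ltnW // ltnS.
Qed.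

(** * Sign changes of a periodic sequence without low frequencies *)

Section SignChanges.

Variables (h : nat -> R) (d m : nat).
Hypothesis h_neq0 : forall k, h k != 0.
Hypothesis h_period : h d = h 0%N.
Hypothesis d_gt0 : (0 < d)%N.
Let omega : R := 2 * pi / d%:R.
Hypothesis h_orth : forall l phi, (l < m)%N ->
  \sum_(k < d) cos (k%:R * (l%:R * omega) + phi) * h k = 0.

(** A product of two sines of half the basic frequency mixes the frequencies 0 and [omega], so each
    pair of factors moves [l] by at most one; hence the bound on [l + n]. *)
Lemma orth_prod_sin n (ts : seq R) l phi : size ts = n.*2 -> (l + n < m)%N ->
  \sum_(k < d) (\prod_(t <- ts) sin (k%:R * omega / 2 - t)) *
     cos (k%:R * (l%:R * omega) + phi) * h k = 0.
Proof.
elim: n ts l phi => [|n IHn] ts l phi.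
  move=> /size0nil->; rewrite addn0 => lm; rewrite -[RHS](h_orth phi lm).
  by apply: eq_bigr => k _; rewrite big_nil mul1r.
case: ts => [|t1 [|t2 ts]] //= [sz] lm; set P := fun k : nat =>
  \prod_(t <- ts) sin (k%:R * omega / 2 - t).
have lm' : (l + n < m)%N by apply: leq_ltn_trans lm; rewrite leq_add2l.
pose g l' f := \sum_(k < d) P k * cos (k%:R * (l'%:R * omega) + f) * h k.
have g0 l' f : (l' <= l.+1)%N -> g l' f = 0.
  by move=> l'l; apply: IHn => //; apply: leq_ltn_trans lm; rewrite -addSnnS leq_add2r.
pose gm f := \sum_(k < d) P k * cos (k%:R * (l%:R * omega - omega) + f) * h k.
have gm0 f : gm f = 0.
  (* For [l = 0] the frequency -1 is turned into 1 by parity of the cosine, which negates the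
     phase. *)
  rewrite /gm; have [->|l0] := posnP l.
    rewrite -[RHS](g0 1%N (- f)) //; apply: eq_bigr => k _.
    by rewrite -cosN; congr (_ * cos _ * _); ring.
  rewrite -[RHS](g0 l.-1 f) ?(leq_trans (leq_pred l)) //.
  apply: eq_bigr => k _; congr (_ * cos _ * _).
  by rewrite -[in LHS](prednK l0) -natr1; ring.
pose c := cos (t1 - t2) / 2.
transitivity (c * g l phi - (g l.+1 (phi - t1 - t2) + gm (phi + t1 + t2)) / 4).
  rewrite /g /gm -big_split /= mulr_sumr mulr_suml -sumrB.
  apply: eq_bigr => k _; rewrite !big_cons -/(P k) /c.
  set y := k%:R * omega / 2.
  have -> : k%:R * (l.+1%:R * omega) + (phi - t1 - t2) =
     (k%:R * (l%:R * omega) + phi) + ((y - t1) + (y - t2)).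
    by rewrite /y -natr1; field.
  have -> : k%:R * (l%:R * omega - omega) + (phi + t1 + t2) =
     (k%:R * (l%:R * omega) + phi) - ((y - t1) + (y - t2)).
    by rewrite /y; field.
  have -> : t1 - t2 = (y - t2) - (y - t1) by ring.
  move: (k%:R * (l%:R * omega) + phi) (y - t1) (y - t2) (P k) => b a1 a2 Pk.
  by rewrite [cos (b + _)]cosD [cos (b - _)]cosB [cos (a2 - a1)]cosB cosD; field.
by rewrite gm0 !g0 // mulr0 addr0 mul0r subr0.
Qed.

(* If [h] had only [2n < 2m] sign changes, a product of [2n] factors
   [sin ((x - t) / 2)] vanishing between consecutive samples of opposite signs
   would be a trigonometric polynomial of degree [n] with the signs of [h]. *)
Lemma sign_changes_ge :
  (2 * m <= \sum_(k < d) ((h k < 0)%R (+) (h k.+1 < 0)%R))%N.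
Proof.
pose ch k := (h k < 0) (+) (h k.+1 < 0).
pose ks := [seq k <- iota 0 d | ch k].
have signE j : (h j < 0) = (h 0%N < 0) (+) odd (count ch (iota 0 j)).
  elim: j => [|j IHj]; first by rewrite addbF.
  rewrite -addn1 iotaD count_cat /= add0n addn0 oddD addbA -IHj oddb /ch addn1.
  by rewrite addbA addbb.
have -> : (\sum_(k < d) ((h k < 0)%R (+) (h k.+1 < 0)%R))%N = size ks.
  rewrite size_filter; elim: d => [|n IHn]; first by rewrite big_ord0.
  by rewrite big_ord_recr -[in RHS]addn1 iotaD count_cat /= IHn add0n addn0.
(* Over a full period the sign returns to itself, so the number of changes is even and the sine
   factors can be paired. *)
have : ~~ odd (size ks).
  have := signE d; rewrite h_period size_filter.
  by case: (h 0%N < 0); case: (odd _).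
rewrite leqNgt; move=> evk; apply/negP=> ltk.
have szk : size ks = (size ks)./2.*2 by rewrite even_halfK.
have nm : ((size ks)./2 < m)%N.
  by rewrite -ltn_double -szk -mul2n.
pose ts := [seq (k%:R + 2^-1) * omega / 2 | k <- ks].
have := @orth_prod_sin _ ts 0%N 0; rewrite size_map => /(_ _ szk nm).
have d0 : 0 < d%:R :> R by rewrite ltr0n.
have om0 : 0 < omega by rewrite /omega divr_gt0 // mulr_gt0 // pi_gt0.
have omd : d%:R * omega = 2 * pi :> R by rewrite mulrC divfK // gt_eqF.
pose Q (j : nat) := \prod_(k <- ks) sin ((j%:R - (k%:R + 2^-1)) * omega / 2).
(* The zeros sit half-way between samples and the arguments stay strictly between [- pi] and
   [pi]. *)
have sgn j k : (j < d)%N -> (k < d)%N ->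
    let x := sin ((j%:R - (k%:R + 2^-1)) * omega / 2) in
    x != 0 /\ (x < 0) = (j <= k)%N.
  move=> jd kd /=.
  have jd1 : j%:R + 1 <= d%:R :> R by rewrite natr1 ler_nat.
  have kd1 : k%:R + 1 <= d%:R :> R by rewrite natr1 ler_nat.
  have j0 : 0 <= j%:R :> R by [].
  have k0 : 0 <= k%:R :> R by [].
  case: leqP => jk.
    have {}jk : j%:R <= k%:R :> R by rewrite ler_nat.
    suff : 0 < sin (- ((j%:R - (k%:R + 2^-1)) * omega / 2)).
      by rewrite sinN oppr_gt0 => x0; rewrite x0 lt_eqF.
    by apply: sin_gt0_pi; apply/andP; split; nra.
  have {}jk : k%:R + 1 <= j%:R :> R by rewrite natr1 ler_nat.
  suff : 0 < sin (((j%:R - (k%:R + 2^-1)) * omega / 2)).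
    by move=> x0; rewrite gt_eqF // lt_gtF.
  by apply: sin_gt0_pi; apply/andP; split; nra.
have ksd k : k \in ks -> (k < d)%N.
  by rewrite mem_filter mem_iota add0n => /andP[_ /andP[]].
(* The sign of [Q j] counts the changes from [j] on, that of [h j] relative to [h 0] those before
   [j]; their total is even. *)
have Qh j : (j < d)%N -> (Q j * h j != 0) && ((Q j * h j < 0) == (h 0%N < 0)).
  move=> jd; have [|Q0 QE] := @prod_lt0 _ ks
     (fun k => sin ((j%:R - (k%:R + 2^-1)) * omega / 2)).
    by move=> k /ksd kd; have [] := sgn j k jd kd.
  rewrite -/(Q j) in Q0 QE; rewrite mulf_neq0 //=.
  have -> : (Q j * h j < 0) = (Q j < 0) (+) (h j < 0).
    case: (ltrgt0P (Q j)) Q0 => // Qj _; first by rewrite pmulr_rlt0.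
    by rewrite nmulr_rlt0 // lt_def h_neq0 leNgt.
  have cE : count (fun k => sin ((j%:R - (k%:R + 2^-1)) * omega / 2) < 0) ks
          = count ch (iota j (d - j)).
    rewrite (@eq_in_count _ _ (fun k => (j <= k)%N)); last first.
      by move=> k /ksd kd; have [] := sgn j k jd kd.
    rewrite /ks count_filter -{1}(subnKC (ltnW jd)) iotaD count_cat add0n.
    rewrite (@eq_in_count _ _ pred0) ?count_pred0; last first.
      by move=> k; rewrite mem_iota add0n /= => /ltn_geF ->.
    by rewrite add0n; apply: eq_in_count => k; rewrite mem_iota /= => /andP[-> _].
  rewrite QE cE signE [X in _ (+) X == _]addbC addbA -oddD.
  rewrite addnC -count_cat -{1}[j]add0n -iotaD subnKC ?(ltnW jd) //.
  by rewrite -size_filter -/ks (negPf evk).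
under eq_bigr => k _.
  rewrite mul0r mulr0 addr0 cos0 mulr1 big_map.
  under eq_bigr => i _ do rewrite -mulrBl -mulrBl.
  rewrite -/(Q k); over.
move/eqP; apply/negP; case: (boolP (h 0%N < 0)) => h00.
  rewrite -oppr_eq0 -sumrN gt_eqF //.
  apply: (@sum_ord_gt0 _ (fun k => - (Q k * h k))) => // k kd.
  by have /andP[_ /eqP QE] := Qh k kd; rewrite oppr_gt0 QE.
rewrite gt_eqF //.
apply: (@sum_ord_gt0 _ (fun k => Q k * h k)) => // k kd.
by have /andP[Q0 /eqP QE] := Qh k kd; rewrite lt_def Q0 leNgt QE.
Qed.

End SignChanges.

End Sinusoids.

(** * Euclidean geometry: half-spaces, hyperplanes, reflections *)

Section Euclidean.

Local Open Scope classical_set_scope.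
Local Open Scope ring_scope.
Variables (R : realType) (V : finNormedModType R) (ip : {dot V for idfun}).
Hypothesis ip_norm : forall v : V, `|v| ^+ 2 = ip v v.
Implicit Types (a u v w : V) (H : {vspace V}).

Lemma ip_sym u v : ip u v = ip v u.
Proof. by rewrite hermC expr0 mul1r. Qed.

Lemma ipDl u v w : ip (u + v) w = ip u w + ip v w.
Proof. exact: linearDl. Qed.

Lemma ipDr u v w : ip u (v + w) = ip u v + ip u w.
Proof. exact: linearDr. Qed.

Lemma ipZl k u v : ip (k *: u) v = k * ip u v.
Proof. exact: linearZl_LR. Qed.

Lemma ipZr k u v : ip u (k *: v) = k * ip u v.
Proof. by rewrite ip_sym ipZl ip_sym. Qed.

Lemma ipNl u v : ip (- u) v = - ip u v.
Proof. exact: linearNl. Qed.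

Lemma ipNr u v : ip u (- v) = - ip u v.
Proof. exact: linearNr. Qed.

Lemma ip0l u : ip 0 u = 0.
Proof. exact: linear0l. Qed.

Lemma ip0r u : ip u 0 = 0.
Proof. exact: linear0r. Qed.

Lemma ip_suml I (r : seq I) (P : pred I) (F : I -> V) u :
  ip (\sum_(i <- r | P i) F i) u = \sum_(i <- r | P i) ip (F i) u.
Proof. exact: linear_sumlz. Qed.

Lemma ip_eq0 u : ip u u = 0 -> u = 0.
Proof. by rewrite -ip_norm => /eqP; rewrite sqrf_eq0 normr_eq0 => /eqP. Qed.

Lemma ip_gt0 u : u != 0 -> 0 < ip u u.
Proof. by move=> u0; rewrite -ip_norm exprn_gt0 // normr_gt0. Qed.

(** Polarization expresses the form through the norm, which is continuous. *)
Lemma ip_continuous a : continuous (fun v => ip v a).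
Proof.
have -> : (fun v => ip v a) =
    (fun v => (`|v + a| ^+ 2 - `|v| ^+ 2 - `|a| ^+ 2) / 2).
  by apply/funext=> v; rewrite !ip_norm !(ipDl, ipDr) (ip_sym a v); field.
move=> v; apply: cvgM; last exact: cvg_cst.
have sqr_cont : continuous (fun w : V => `|w| ^+ 2).
  move=> w; apply: (@continuous_comp _ _ _ (fun u : V => `|u|) (fun x => x ^+ 2)).
    exact: norm_continuous.
  exact: exprn_continuous.
apply: cvgB; last exact: cvg_cst.
apply: cvgB; last exact: sqr_cont.
apply: (@continuous_comp _ _ _ (fun u : V => u + a) (fun u : V => `|u| ^+ 2)).
  by apply: cvgD; [exact: cvg_id|exact: cvg_cst].
exact: sqr_cont.
Qed.

Lemma connected_pos (A : set V) a u v : connected A ->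
  (forall w, A w -> ip w a != 0) -> A u -> A v -> 0 < ip u a -> 0 < ip v a.
Proof.
move=> cA A0 Au Av ua.
have /connected_intervalP iI : connected ((fun w => ip w a) @` A).
  apply: connected_continuous_connected => //.
  by apply: continuous_subspaceT; apply: ip_continuous.
rewrite lt_neqAle eq_sym A0 // leNgt; apply/negP=> va.
have [w Aw w0] : ((fun w => ip w a) @` A) 0.
  apply: (iI (ip v a) (ip u a)); [by exists v|by exists u|].
  by rewrite !ltW.
by have := A0 w Aw; rewrite w0 eqxx.
Qed.

Lemma closure_nneg (A : set V) a v : (forall w, A w -> 0 < ip w a) ->
  closure A v -> 0 <= ip v a.
Proof.
move=> A0 Av.
have cl : closed ((fun w => ip w a) @^-1` [set x | 0 <= x])%classic.
  apply: preimage_closed; first by move=> w _; apply: ip_continuous.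
  exact: closed_ge.
have := closureS (_ : (A `<=` (fun w => ip w a) @^-1` [set x | 0 <= x])%classic).
rewrite -((closure_id _).1 cl); apply=> //.
by move=> w /A0 /ltW.
Qed.

Lemma mem_orth_line u a : (u \in orthov ip <[a]>%VS) = (ip u a == 0).
Proof. exact: mem_orthov1. Qed.

(** Cutting the whole space by the orthogonal of each basis vector of [H] lowers the dimension by at
    most one each time, so a nonzero vector orthogonal to [H] remains; it is then normalized. *)
Lemma hyperplane_normal H : hyperplane H ->
  exists2 a, ip a a = 1 & H = orthov ip <[a]>%VS.
Proof.
rewrite /hyperplane => dimH.
have perp (s : seq V) : (\dim {:V} - size s <=
    \dim (foldr (fun u U => U :&: orthov ip <[u]>) fullv s)%VS)%N.
  elim: s => [|u s IHs] /=; first by rewrite subn0.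
  apply: leq_trans (leq_dim_orthov1 _ _ _); rewrite subnS.
  by rewrite -!subn1 leq_sub2r.
have perpP (s : seq V) a : a \in foldr (fun u U => (U :&: orthov ip <[u]>)%VS) fullv s ->
    {in s, forall u, ip a u = 0}.
  elim: s => [|u s IHs] //=; rewrite memv_cap => /andP[/IHs as0 au] w.
  by rewrite inE => /orP[/eqP->|/as0//]; rewrite mem_orth_line in au; apply/eqP.
have := perp (vbasis H); rewrite size_tuple -dimH subSnn => dimP.
set P := foldr _ _ _ in dimP.
pose b := vpick P.
have b0 : b != 0 by rewrite vpick0 -dimv_eq0 -lt0n.
have bH : {in H, forall u, ip b u = 0}.
  move=> u /coord_vbasis ->; rewrite ip_sym ip_suml big1 // => i _.
  by rewrite ipZl ip_sym (perpP _ _ (memv_pick P)) ?mulr0 // mem_nth // size_tuple.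
pose a := (Num.sqrt (ip b b))^-1 *: b.
have aa : ip a a = 1.
  rewrite ipZl ipZr mulrA -invfM -expr2 sqr_sqrtr ?ltW ?ip_gt0 //.
  by rewrite mulVf // gt_eqF // ip_gt0.
exists a => //; apply/eqP; rewrite eqEdim; apply/andP; split.
  by apply/subvP=> u uH; rewrite mem_orth_line /a ipZr (ip_sym u) (bH u uH) mulr0.
rewrite -ltnS dimH ltn_neqAle dimvS ?subvf // andbT.
apply/negP=> /eqP full; have : (orthov ip <[a]> == fullv)%VS.
  by rewrite eqEdim subvf full leqnn.
move/eqP/vspaceP/(_ a); rewrite memvf mem_orth_line aa oner_eq0 //.
Qed.

Definition refl a v := v - (2 * ip v a) *: a.

Lemma refl_orth_reflection H (f : 'End(V)) : hyperplane H ->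
  orth_reflection ip H f ->
  exists a, [/\ ip a a = 1, H = orthov ip <[a]>%VS & f =1 refl a].
Proof.
move=> hH [fH fN]; have [a aa HE] := hyperplane_normal hH; exists a; split=> // v.
have aN : a \in orthov ip H.
  apply/mem_orthovP => u; rewrite HE mem_orth_line => /eqP ua.
  exact: etrans (ip_sym a u) ua.
have vH : v - ip v a *: a \in H.
  by rewrite HE mem_orth_line ipDl ipNl ipZl aa mulr1 subrr.
have -> : f v = f (v - ip v a *: a) + ip v a *: f a.
  by rewrite -linearZ -linearD subrK.
rewrite (fH _ vH) (fN _ aN) scalerN.
by rewrite /refl mulr2n mulrDl mul1r scalerDl opprD addrA.
Qed.

Lemma refl_hyperplane a (f : 'End(V)) : ip a a = 1 -> f =1 refl a ->
  hyperplane (orthov ip <[a]>%VS) /\ orth_reflection ip (orthov ip <[a]>%VS) f.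
Proof.
move=> aa fE; split.
  have := @eq_dim_orthov1 _ _ _ _ ip a fullv; rewrite capfv /hyperplane => <-.
    rewrite prednK // lt0n dimv_eq0; apply/negP=> /eqP V0.
    have : a \in (0%VS : {vspace V}) by rewrite -V0 memvf.
    rewrite memv0 => /eqP a0; move: aa.
    by rewrite a0 ip0l => /eqP; rewrite eq_sym oner_eq0.
  apply/mem_orthovPn; exists a; rewrite ?memvf //.
  have a0 : ip a a != 0 by rewrite aa oner_neq0.
  exact: a0.
split=> v.
  by rewrite mem_orth_line fE /refl => /eqP->; rewrite mulr0 scale0r subr0.
move/mem_orthovP=> vN; have {}vN w : ip w a = 0 -> ip v w = 0.
  by move=> wa; apply: vN; rewrite mem_orth_line wa.
have vE : v = ip v a *: a.
  apply/subr0_eq/ip_eq0; have ra : ip (v - ip v a *: a) a = 0.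
    by rewrite ipDl ipNl ipZl aa mulr1 subrr.
  by rewrite ipDl ipNl ipZl (vN _ ra) ip_sym ip_sym [ip a _]ip_sym ra mulr0 subr0.
by rewrite fE /refl {3}vE mulr2n mulrDl mul1r scalerDl -vE opprD addrA subrr sub0r.
Qed.

Lemma refl_inj a b : ip a a = 1 -> ip b b = 1 -> refl a =1 refl b ->
  exists e : bool, a = (-1) ^+ e *: b.
Proof.
move=> aa bb ab; have := ab a; rewrite /refl aa mulr1 => /addrI/oppr_inj.
rewrite -scalerA => /(scalerI _) aE.
have {}aE : a = ip a b *: b by apply: aE; rewrite pnatr_eq0.
have := aa; rewrite {1 2}aE ipZl ipZr bb mulr1 -expr2 => /eqP.
rewrite sqrf_eq1 => /orP[]/eqP abE; [exists false|exists true];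
  by rewrite ?expr0 ?expr1 -abE.
Qed.

(* For [M] large, [M *: u + v] has the sign of [u] on every [a i] not
   orthogonal to [u], and the sign of [v] on the others. *)
Lemma lexicographic_vector (I : finType) (a : I -> V) (y : nat -> V) n :
  exists v, forall i j, (j < n)%N -> ip (y j) (a i) != 0 ->
    (forall k, (k < j)%N -> ip (y k) (a i) = 0) ->
    Num.sg (ip v (a i)) = Num.sg (ip (y j) (a i)).
Proof.
elim: n y => [|n IHn] y; first by exists 0.
have [v vP] := IHn (fun j => y j.+1).
(* The leading 1 makes the comparison strict; indices with a zero denominator contribute 0, the
   value of a division by zero. *)
pose M := 1 + \sum_i `|ip v (a i)| / `|ip (y 0%N) (a i)|.
exists (M *: y 0%N + v) => i [|j] jn y0 yk; last first.
  rewrite ipDl ipZl yk // mulr0 add0r; apply: vP => // k kj.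
  by rewrite yk.
rewrite ipDl ipZl.
have ylt : `|ip v (a i)| < M * `|ip (y 0%N) (a i)|.
  rewrite -ltr_pdivrMr ?normr_gt0 // /M (bigD1 i) //=.
  rewrite addrCA ltrDl; apply: ltr_pwDl => //.
  by apply: sumr_ge0 => k _; apply: divr_ge0; apply: normr_ge0.
case: (ltrgt0P (ip (y 0%N) (a i))) y0 ylt => // y0 _ ylt.
  rewrite [in RHS]gtr0_sg // gtr0_sg //.
  by have := ler_norm (- ip v (a i)); rewrite normrN; lra.
rewrite [in RHS]ltr0_sg // ltr0_sg //.
by have := ler_norm (ip v (a i)); lra.
Qed.

End Euclidean.

(** * Roots and inversion sets *)

Section RootSystem.

Local Open Scope classical_set_scope.
Local Open Scope ring_scope.
Variables (R : realType) (V : finNormedModType R) (ip : {dot V for idfun}).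
Hypothesis ip_norm : forall v : V, `|v| ^+ 2 = ip v v.
Variables (gT : finGroupType) (W : {group gT}) (S : {set gT}) (delta : gT).
Hypothesis genS : <<S>>%g = W.
Hypothesis twist : twisted_by_delta W S delta.
Variable rho : gT -> 'End(V).
Hypothesis rho_rep : orthogonal_rep ip rho.
Hypothesis rho_refl : forall s : gT, s \in S -> is_reflection ip (rho s).
Variable C : set V.
Hypothesis fundC : fundamental_chamber ip rho W S delta C.
Variable c0 : V.
Hypothesis Cc0 : C c0.
Implicit Types (x y g t s w : gT) (u v a b : V).

Lemma rho1 v : rho 1%g v = v.
Proof. by case: rho_rep => -> _ _ _; rewrite id_lfunE. Qed.

Lemma rhoM x y v : rho (x * y)%g v = rho x (rho y v).
Proof. by case: rho_rep => _ -> _ _; rewrite comp_lfunE. Qed.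

Lemma rhoK x v : rho x^-1%g (rho x v) = v.
Proof. by rewrite -rhoM mulVg rho1. Qed.

Lemma rhoVK x v : rho x (rho x^-1%g v) = v.
Proof. by rewrite -rhoM mulgV rho1. Qed.

Lemma ip_rho x u v : ip (rho x u) v = ip u (rho x^-1%g v).
Proof.
case: rho_rep => _ _ _ isom.
by rewrite -(isom x^-1%g) rhoK.
Qed.

Lemma rho_lfun_inj x y : rho x =1 rho y -> x = y.
Proof. by case: rho_rep => _ _ inj _ xy; apply/inj/lfunP. Qed.

(** Roots have unit length, so a reflection determines its root up to sign. *)
Definition is_root t a := ip a a = 1 /\ rho t =1 refl ip a.

Lemma is_rootJ t a g : is_root t a -> is_root (t ^ g)%g (rho g^-1%g a).
Proof.
case=> aa ta; split; first by rewrite ip_rho invgK rhoVK.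
move=> v; rewrite conjgE !rhoM ta /refl linearB linearZ /= rhoK.
by rewrite ip_rho.
Qed.

Definition reflections : {set gT} :=
  finset (fun t => (t \in W) && `[< exists a, is_root t a >]).

Lemma reflectionsP t :
  reflect (t \in W /\ exists a, is_root t a) (t \in reflections).
Proof.
rewrite inE; apply: (iffP andP) => [[tW /asboolP]|[tW ta]] //.
by split=> //; apply/asboolP.
Qed.

Lemma W_normal g : (W :^ g)%g = W.
Proof.
case: twist => /sdprodP[_ defG nWd _] _ _.
have : g \in (W * <[delta]>)%g by rewrite defG inE.
case/mulsgP=> w d wW dd ->; rewrite conjsgM conjGid //.
exact/normP/(fintype.subsetP nWd).
Qed.

Lemma reflectionsJ t g : (t ^ g \in reflections)%g = (t \in reflections).
Proof.
have sub h r : r \in reflections -> (r ^ h \in reflections)%g.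
  case/reflectionsP=> rW [a ra]; apply/reflectionsP; split.
    by rewrite -(W_normal h) memJ_conjg.
  by exists (rho h^-1%g a); apply: is_rootJ.
by apply/idP/idP=> /sub; [move/(_ g^-1%g); rewrite conjgK|apply].
Qed.

Lemma root_hyperplane t a : t \in W -> is_root t a ->
  reflecting_hyperplanes ip rho W (orthov ip <[a]>%VS).
Proof.
move=> tW [aa ta]; have [hH oH] := refl_hyperplane ip_norm aa ta.
by split=> //; exists t.
Qed.

Lemma chamber_root A c t a : chamber ip rho W A -> A c -> t \in W ->
  is_root t a -> ip c a != 0.
Proof.
move=> [c' _ ->] /connected_component_sub cH tW ta; apply/negP=> ca; apply: cH.
exists (orthov ip <[a]>%VS); first exact: root_hyperplane ta.
by rewrite /= mem_orth_line.
Qed.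

Lemma chamber_pos A c c' t a : chamber ip rho W A -> A c -> A c' -> t \in W ->
  is_root t a -> 0 < ip c a -> 0 < ip c' a.
Proof.
move=> chA Ac Ac' tW ta; apply: (connected_pos ip_norm) Ac Ac'.
  by case: chA => c1 _ ->; apply: component_connected.
by move=> w Aw; apply: chamber_root chA Aw tW ta.
Qed.

Lemma chamberC : chamber ip rho W C. Proof. by case: fundC. Qed.

(** This is the positive root, the one on the side of [c0]; by [rootP] the default 0 never occurs on
    [reflections]. *)
Definition root t : V := xget 0 [set a | is_root t a /\ 0 < ip c0 a].

Lemma rootP t : t \in reflections -> is_root t (root t) /\ 0 < ip c0 (root t).
Proof.
case/reflectionsP=> tW [a ta].
suff ex : exists a, is_root t a /\ 0 < ip c0 a.
  exact: (@xgetPex _ 0 [set b | is_root t b /\ 0 < ip c0 b] ex).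
case: (ltrgt0P (ip c0 a)) (chamber_root chamberC Cc0 tW ta) => // c0a _.
  by exists a.
exists (- a); split; last by rewrite ipNr oppr_gt0.
case: ta => aa ta; split; first by rewrite ipNl ipNr opprK.
by move=> v; rewrite ta /refl ipNr mulrN scaleNr scalerN opprK.
Qed.

Lemma is_root_unique t a b : is_root t a -> is_root t b ->
  exists e : bool, a = (-1) ^+ e *: b.
Proof.
case=> aa ta [bb tb]; apply: (refl_inj aa bb) => v.
by rewrite -ta tb.
Qed.

Definition inv x : {set gT} :=
  finset (fun t => (t \in reflections) && (ip (rho x c0) (root t) < 0)).

Lemma inv_sub x t : t \in inv x -> t \in reflections.
Proof. by rewrite inE => /andP[]. Qed.

Lemma mem_inv x t : t \in reflections ->
  (t \in inv x) = (ip (rho x c0) (root t) < 0).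
Proof. by move=> tT; rewrite finset.in_set tT. Qed.

(** The left side is a unit normal for [t ^ g], hence plus or minus its positive root; pairing with
    [c0] identifies the sign. The cocycle rule follows from this. *)
Lemma rho_root g t : t \in reflections ->
  rho g^-1%g (root t) = (-1) ^+ (t \in inv g) *: root (t ^ g)%g.
Proof.
move=> tT; have [tr _] := rootP tT.
have [tgr tg0] := rootP (etrans (reflectionsJ t g) tT).
have [e eE] := is_root_unique (is_rootJ g tr) tgr.
rewrite eE mem_inv // ip_rho eE ipZr; case: e {eE} => /=.
  by rewrite mulN1r oppr_lt0 tg0.
by rewrite expr0 mul1r ltNge ltW.
Qed.

Lemma ip_rho_root g v t : t \in reflections ->
  ip (rho g v) (root t) = (-1) ^+ (t \in inv g) * ip v (root (t ^ g)%g).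
Proof. by move=> tT; rewrite ip_rho rho_root // ipZr. Qed.

Definition generic v := {in reflections, forall t, ip v (root t) != 0}.

Lemma genericM g v : generic v -> generic (rho g v).
Proof.
move=> gv t tT; rewrite ip_rho_root // mulf_neq0 ?signr_eq0 // gv //.
by rewrite reflectionsJ.
Qed.

Lemma generic_c0 : generic c0.
Proof. by move=> t /rootP[_ c0t]; rewrite gt_eqF. Qed.

Lemma signM_lt0 (e : bool) (r : R) : r != 0 ->
  ((-1) ^+ e * r < 0) = e (+) (r < 0).
Proof.
case: e => r0; last by rewrite expr0 mul1r.
by rewrite mulN1r oppr_lt0 lt_def r0 leNgt.
Qed.

Lemma ip_rho_root_lt0 g v t : generic v -> t \in reflections ->
  (ip (rho g v) (root t) < 0) = (t \in inv g) (+) (ip v (root (t ^ g)%g) < 0).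
Proof. by move=> gv tT; rewrite ip_rho_root // signM_lt0 // gv // reflectionsJ. Qed.

Lemma mem_invM x y t :
  (t \in inv (x * y)%g) = (t \in inv x) (+) ((t ^ x)%g \in inv y).
Proof.
case: (boolP (t \in reflections)) => tT; last first.
  by rewrite [in LHS]inE [t \in inv x]inE [(t ^ x)%g \in _]inE reflectionsJ
    (negPf tT).
rewrite mem_inv // rhoM ip_rho_root_lt0 ?mem_inv ?reflectionsJ //.
exact: genericM generic_c0.
Qed.

(** Choose [w] maximizing [ip (rho w y) c0]. A positive root negative on [rho w y] would give a
    reflection increasing this value, so [rho w y] is positive on all of them and [w^-1] has the
    required inversions. *)
Lemma realize_signs (y : V) : generic y -> exists2 w, w \in W &
  {in reflections, forall t, (t \in inv w) = (ip y (root t) < 0)}.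
Proof.
move=> gy.
pose w := [arg max_(w > 1%g in W) ip (rho w y) c0]%O.
have [wW wmax] : w \in W /\ forall w', w' \in W ->
    ip (rho w' y) c0 <= ip (rho w y) c0.
  by rewrite /w; case: arg_maxP => [|w' w'W mx]; rewrite ?group1.
have pos t : t \in reflections -> 0 < ip (rho w y) (root t).
  move=> tT; have [[_ tr] ct] := rootP tT; have /reflectionsP[tW _] := tT.
  rewrite lt_neqAle eq_sym genericM //=.
  have := wmax _ (groupM tW wW); rewrite rhoM tr /refl ipDl ipNl ipZl.
  rewrite gerDl oppr_le0 (ip_sym ip (root t)) -mulrA pmulr_rge0 // pmulr_lge0 //.
exists w^-1%g; first by rewrite groupV.
move=> t tT; rewrite -{1}(rhoK w y) ip_rho_root_lt0 //; last exact: genericM.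
by rewrite [_ < 0]ltNge ltW ?addbF // pos // reflectionsJ.
Qed.

Lemma S_sub_W s : s \in S -> s \in W.
Proof. by move=> sS; rewrite -genS mem_gen. Qed.

Lemma simple_reflection s : s \in S -> s \in reflections.
Proof.
move=> sS; apply/reflectionsP; split; first exact: S_sub_W.
have [H [hH oH]] := rho_refl sS.
by have [a [aa _ sa]] := refl_orth_reflection ip_norm hH oH; exists a.
Qed.

Lemma root_orth_inj s t : s \in reflections -> t \in reflections ->
  (orthov ip <[root s]> <= orthov ip <[root t]>)%VS -> s = t.
Proof.
move=> sT tT st; have [[ss sr] _] := rootP sT; have [[tt tr] _] := rootP tT.
have [hs _] := refl_hyperplane ip_norm ss sr.
have [ht oht] := refl_hyperplane ip_norm tt tr.
have stE : orthov ip <[root s]>%VS = orthov ip <[root t]>%VS.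
  apply/eqP; rewrite eqEdim st /= -ltnS.
  by move: hs ht; rewrite /hyperplane => -> ->.
apply: rho_lfun_inj => v; rewrite -stE in oht.
have : orth_reflection ip (orthov ip <[root s]>%VS) (rho s).
  by have [] := refl_hyperplane ip_norm ss sr.
case=> s1 s2; case: oht => t1 t2.
pose u := ip v (root s) *: root s.
have vE : v = (v - u) + u by rewrite subrK.
have uN : u \in orthov ip (orthov ip <[root s]>%VS).
  apply/memvZ/mem_orthovP => x; rewrite mem_orth_line => /eqP xs.
  exact: etrans (ip_sym _ _ _) xs.
have vH : v - u \in orthov ip <[root s]>%VS.
  by rewrite mem_orth_line /u ipDl ipNl ipZl ss mulr1 subrr.
have lin g : rho g v = rho g (v - u) + rho g u by rewrite -linearD -vE.
by rewrite !lin (s1 _ vH) (t1 _ vH) (s2 _ uN) (t2 _ uN).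
Qed.

(** The face of [C] in the wall of [s] spans that wall, so for each reflection [t != s] it has a
    point off the hyperplane of [t]. The sum [q] of these points is fixed by [s] and positive on
    every other positive root, so [s] inverts no other reflection. *)
Lemma inv_simple : {in S, forall s, inv s = [set s]%SET}.
Proof.
move=> s sS; have sT := simple_reflection sS; have [[ss sr] cs] := rootP sT.
have [ch wallC _] := fundC; set H := orthov ip <[root s]>%VS.
have [hH oH] := refl_hyperplane ip_norm ss sr.
have [_ wallH] : wall ip rho W C H by apply/wallC; split=> //; exists s.
have facet t : exists p, t \in reflections -> t != s ->
    [/\ ip p (root s) = 0, 0 < ip p (root t) &
        {in reflections, forall r, 0 <= ip p (root r)}].
  case: (boolP ((t \in reflections) && (t != s))) => [/andP[tT ts]|]; last first.
    by rewrite negb_and => /orP[/negPf->|/negPf->]; exists 0.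
  have : ~ (closure C `&` [set` H] `<=` [set` orthov ip <[root t]>%VS]).
    by move=> /wallH /root_orth_inj st; rewrite st ?eqxx in ts.
  move=> /existsNP[p /not_implyP[[Cp Hp] tp]]; exists p => _ _.
  have p0 r : r \in reflections -> 0 <= ip p (root r).
    move=> rT; have [rr cr] := rootP rT; have /reflectionsP[rW _] := rT.
    apply: (closure_nneg ip_norm) Cp => c Cc.
    exact: chamber_pos chamberC Cc0 Cc rW rr cr.
  split=> //; first by move: Hp; rewrite /= mem_orth_line => /eqP.
  rewrite lt_neqAle p0 // eq_sym andbT.
  by apply/negP; rewrite -mem_orth_line; move/negP: tp => /negP.
have [p pP] := choice facet.
pose q := \sum_(t | (t \in reflections) && (t != s)) p t.
have qs : ip q (root s) = 0.
  by rewrite ip_suml big1 // => t /andP[tT ts]; have [] := pP t tT ts.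
have q0 t : t \in reflections -> t != s -> 0 < ip q (root t).
  move=> tT ts; rewrite ip_suml (bigD1 t) ?tT //= ltr_pwDl //.
    by have [] := pP t tT ts.
  apply: sumr_ge0 => r /andP[/andP[rT rs] _].
  by have [_ _] := pP r rT rs; apply.
apply/finset.setP=> t; rewrite finset.in_set1.
case: (boolP (t \in reflections)) => tT; last first.
  by rewrite inE (negPf tT); apply/esym/negbTE; apply: contraNneq tT => ->.
have [->|ts] := eqVneq t s.
  rewrite mem_inv // sr /refl ipDl ipNl ipZl ss mulr1.
  by rewrite mulr2n mulrDl mul1r opprD addrA subrr sub0r oppr_lt0.
have qE : rho s q = q by rewrite sr /refl qs mulr0 scale0r subr0.
have tsT : (t ^ s)%g \in reflections by rewrite reflectionsJ.
have tsn : (t ^ s)%g != s.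
  apply: contraNneq ts => tsE.
  by rewrite -(conjgK s t) tsE conjgE invgK mulgV mulg1.
have := ip_rho_root s q tT; rewrite qE.
case: (t \in inv s) => //=; rewrite mulN1r => qt.
by have := q0 t tT ts; rewrite qt oppr_gt0 ltNge ltW // q0.
Qed.

Lemma inv_delta : inv delta = finset.set0.
Proof.
have [_ _ dC] := fundC.
apply/finset.setP=> t; rewrite finset.in_set0; apply/negbTE/negP=> td.
have tT := inv_sub td; move: td; rewrite mem_inv //; apply/negP.
have [tr ct] := rootP tT; have /reflectionsP[tW _] := tT.
rewrite -leNgt ltW //; apply: chamber_pos chamberC Cc0 _ tW tr ct.
by rewrite -dC; exists c0.
Qed.

End RootSystem.

(** * Angle spaces *)

Section AngleSpaces.

Import passmx.
Local Open Scope classical_set_scope.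
Local Open Scope ring_scope.
Variables (R : realType) (V : finNormedModType R) (ip : {dot V for idfun}).
Hypothesis ip_norm : forall v : V, `|v| ^+ 2 = ip v v.
Variables (gT : finGroupType) (rho : gT -> 'End(V)).
Hypothesis rho_rep : orthogonal_rep ip rho.
Implicit Types (x g : gT) (u v w c : V) (t psi phi : R).

Local Notation rhoM := (rhoM rho_rep).

Lemma mem_angle_space x t v :
  (v \in angle_space rho x t) = (rho x v + rho x^-1%g v == (2 * cos t) *: v).
Proof.
by rewrite memv_ker !lfunE /= !lfunE /= !lfunE /= id_lfunE subr_eq0.
Qed.

Lemma angle_space_comm x g t v : commute x g ->
  v \in angle_space rho x t -> rho g v \in angle_space rho x t.
Proof.
move=> xg; rewrite !mem_angle_space => /eqP vE.
by rewrite -linearZ -vE linearD /= -!rhoM xg (commuteV (commute_sym xg)).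
Qed.

Lemma angle_spaceX x k t v :
  v \in angle_space rho x t -> rho (x ^+ k)%g v \in angle_space rho x t.
Proof. exact/angle_space_comm/commuteX. Qed.

Lemma angle_spaceXV x k t v :
  v \in angle_space rho x t -> rho (x ^+ k)^-1%g v \in angle_space rho x t.
Proof. by apply: angle_space_comm; apply/commuteV/commuteX. Qed.

Lemma angle_spaceJ x g t v : (rho g v \in angle_space rho x t) =
  (v \in angle_space rho (x ^ g)%g t).
Proof.
have gK := rhoK rho_rep g; have gVK := rhoVK rho_rep g.
rewrite !mem_angle_space -conjVg !conjgE !rhoM -linearD -linearZ.
by apply/eqP/eqP => [->|<-] /=; rewrite ?gK ?gVK.
Qed.

(** [x] turns [v] by the angle [t] in the plane of [v] and [u = (x v - cos t v) / sin t]. If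
    [sin t = 0], then [x v - cos t v] has norm 0, and [u = 0] serves. *)
Lemma angle_rotation x t v : v \in angle_space rho x t ->
  exists u, [/\ u \in angle_space rho x t, ip v u = 0 &
    forall k, rho (x ^+ k)%g v = cos (k%:R * t) *: v + sin (k%:R * t) *: u].
Proof.
move=> vt; have := vt; rewrite mem_angle_space => /eqP vE.
have xv : ip (rho x v) v = cos t * ip v v.
  have : ip (rho x v + rho x^-1%g v) v = (2 * cos t) * ip v v by rewrite vE ipZl.
  rewrite ipDl [ip (rho x^-1%g v) v](ip_rho rho_rep) invgK (ip_sym ip v (rho x v)).
  by lra.
have xx : ip (rho x v) (rho x v) = ip v v.
  by rewrite (ip_rho rho_rep) (rhoK rho_rep).
have xvt : rho x v \in angle_space rho x t by have := angle_spaceX 1 vt; rewrite expg1.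
have [u [ut vu xvE xuE]] : exists u, [/\ u \in angle_space rho x t, ip v u = 0,
    rho x v = cos t *: v + sin t *: u & rho x u = - sin t *: v + cos t *: u].
  have [s0|s0] := eqVneq (sin t) 0.
    exists 0; rewrite mem0v ip0r !scaler0 addr0; split=> //; last first.
      by rewrite s0 linear0 oppr0 scale0r addr0.
    apply/subr0_eq/(ip_eq0 ip_norm).
    rewrite !(ipDl, ipDr, ipNl, ipNr, ipZl, ipZr) xx (ip_sym ip v) xv.
    have := cos2Dsin2 t; rewrite s0 expr0n addr0 => c2.
    by transitivity ((1 - cos t ^+ 2) * ip v v); [ring | rewrite c2 subrr mul0r].
  have rE : rho x (rho x v) = (2 * cos t) *: rho x v - v.
    by have := congr1 (rho x) vE; rewrite linearD linearZ /= (rhoVK rho_rep) => <-;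
       rewrite addrK.
  exists ((sin t)^-1 *: (rho x v - cos t *: v)); split.
  - by rewrite memvZ // memvB // memvZ.
  - by rewrite ipZr ipDr ipNr ipZr (ip_sym ip v) xv subrr mulr0.
  - by rewrite scalerA divff // scale1r addrC subrK.
  rewrite linearZ linearB linearZ /= rE.
  move: (rho x v) (cos2Dsin2 t) => p cs1; apply: (scalerI s0).
  rewrite scalerA mulfV // scale1r scalerDr !scalerA [sin t * cos t]mulrC.
  rewrite -[_ * _ * _^-1]mulrA mulfV // mulr1 scalerBr scalerA addrCA.
  rewrite addrAC -!scalerBl -(scaleN1r v); congr (_ *: _ + _ *: _); first by ring.
  by rewrite -cs1; ring.
exists u; split=> //; elim=> [|k IHk].
  by rewrite expg0 (rho1 rho_rep) mul0r cos0 sin0 scale1r scale0r addr0.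
rewrite expgS rhoM IHk linearD !linearZ /= xvE xuE.
rewrite -natr1 mulrDl mul1r cosD sinD !scalerDr !scalerA addrACA.
by rewrite -!scalerDl !mulrN [cos (k%:R * t) * sin t + _]addrC.
Qed.

(** Pairing the rotation formula at the order of [x] with [v] gives cosine 1. *)
Lemma angle_period x t v : v \in angle_space rho x t -> v != 0 -> 0 <= t ->
  exists m : nat, #[x]%g%:R * t = m%:R * (2 * pi).
Proof.
move=> vt v0 t0; have [u [_ vu rotE]] := angle_rotation vt.
apply: cos_eq1; first by rewrite mulr_ge0.
have /(congr1 (fun w => ip v w)) := rotE #[x]%g.
rewrite expg_order (rho1 rho_rep) ipDr !ipZr vu mulr0 addr0 => vvE.
by apply: (mulIf (lt0r_neq0 (ip_gt0 ip_norm v0))); rewrite mul1r -vvE.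
Qed.

Lemma sum_shift (F : nat -> V) n : F n = F 0%N ->
  \sum_(k < n) F k.+1 = \sum_(k < n) F k.
Proof.
move=> Fn; have : \sum_(k < n.+1) F k = \sum_(k < n.+1) F k by [].
rewrite {1}big_ord_recl big_ord_recr /= Fn [RHS]addrC => E.
exact: (addrI (F 0%N)).
Qed.

(** A real Fourier coefficient of the orbit of [c], with frequency [psi] and phase [phi]. *)
Definition fourier x c psi phi : V :=
  \sum_(k < #[x]%g) cos (k%:R * psi + phi) *: rho (x ^+ k)%g c.

(** Applying [x] or [x^-1] shifts the summation index around the period, hence the phase by [- psi]
    or [psi]; the two cosines add up to [2 cos psi] times the original one. *)
Lemma fourier_angle_space x c psi phi (l : nat) :
  #[x]%g%:R * psi = l%:R * (2 * pi) ->
  fourier x c psi phi \in angle_space rho x psi.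
Proof.
move=> dpsi; rewrite mem_angle_space /fourier !linear_sum /=.
set d := #[x]%g in dpsi *.
have cosd y : cos (d%:R * psi + y) = cos y by rewrite dpsi addrC cos2pi_nat.
have -> : \sum_(k < d) rho x (cos (k%:R * psi + phi) *: rho (x ^+ k)%g c) =
    \sum_(k < d) cos (k%:R * psi + (phi - psi)) *: rho (x ^+ k)%g c.
  rewrite -(sum_shift (F := fun k => cos (k%:R * psi + (phi - psi)) *:
    rho (x ^+ k)%g c)); last by rewrite cosd expg_order expg0 mul0r add0r.
  apply: eq_bigr => k _; rewrite linearZ /= -rhoM -expgS; congr (cos _ *: _).
  by rewrite -natr1; ring.
have -> : \sum_(k < d) rho x^-1%g (cos (k%:R * psi + phi) *: rho (x ^+ k)%g c) =
    \sum_(k < d) cos (k%:R * psi + (phi + psi)) *: rho (x ^+ k)%g c.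
  rewrite -(sum_shift (F := fun k => rho x^-1%g (cos (k%:R * psi + phi) *:
    rho (x ^+ k)%g c))); last by rewrite cosd expg_order expg0 mul0r add0r.
  apply: eq_bigr => k _; rewrite linearZ /= expgS rhoM (rhoK rho_rep).
  by congr (cos _ *: _); rewrite -natr1; ring.
rewrite -big_split; apply/eqP; apply: eq_bigr => k _ /=.
rewrite -scalerDl scalerA; congr (_ *: _).
by rewrite !addrA cosB [cos (_ + phi + psi)]cosD; ring.
Qed.

(** On the angle space [x] satisfies [X^2 - 2 cos psi X + 1 = (X - lam) (X - lamc)], so
    [z = (x - lamc) v] is an eigenvector unless it vanishes. In that case [v] is one for [lamc], and
    since [v] is real, [sin psi = 0] and [lamc = lam]. *)
Lemma angle_eigenvalue x psi v : v \in angle_space rho x psi -> v != 0 ->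
  eigenvalue (complex_mx (rho x)) (cos psi +i* sin psi)%C.
Proof.
move=> vpsi v0; have := angle_spaceX 1 vpsi; rewrite expg1 mem_angle_space.
rewrite (rhoK rho_rep) => /eqP xxE.
have bP := vbasisP (fullv : {vspace V}).
set M := passmx.mxof (vbasis {:V}) (vbasis {:V}) (rho x).
pose r w := passmx.rVof (vbasis {:V}) w.
have rM w : r w *m M = r (rho x w) by rewrite /r (passmx.rVof_app _ bP).
pose toC := real_complex R; pose rc w := map_mx toC (r w).
have rcM w : rc w *m map_mx toC M = rc (rho x w) by rewrite -map_mxM rM.
have rcB w w' : rc (w - w') = rc w - rc w' by rewrite /rc /r linearB map_mxB.
have rcZ a w : rc (a *: w) = toC a *: rc w by rewrite /rc /r linearZ map_mxZ.
pose lam := (cos psi +i* sin psi)%C; pose lamc := (cos psi +i* - sin psi)%C.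
have lamc1 : lam * lamc = 1.
  apply/eqP; rewrite eq_complex /= mulrN opprK -!expr2 cos2Dsin2 eqxx /=.
  by rewrite mulrN mulrC addNr.
have lamcD : lam + lamc = toC (2 * cos psi).
  apply/eqP; rewrite eq_complex /= subrr eqxx andbT.
  by rewrite mulr2n mulrDl mul1r.
have xxE' : rho x (rho x v) = (2 * cos psi) *: rho x v - v by rewrite -xxE addrK.
pose z := rc (rho x v) - lamc *: rc v.
have zE : z *m map_mx toC M = lam *: z.
  rewrite /z mulmxBl -scalemxAl !rcM xxE' rcB rcZ -lamcD scalerDl scalerBr.
  by rewrite scalerA lamc1 scale1r addrAC addrK.
have [z0|z0] := eqVneq z 0; last by apply/eigenvalueP; exists z.
have rv0 : r v != 0 by rewrite /r (passmx.rVof_eq0 bP).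
have rxE : rc (rho x v) = lamc *: rc v by apply/subr0_eq.
have [j rj0] : exists j, r v 0 j != 0.
  apply/existsP; rewrite -negb_forall; apply: contraNN rv0 => /forallP r0.
  by apply/eqP/rowP=> j; rewrite !mxE; apply/eqP; have := r0 j; rewrite !mxE.
have s0 : sin psi = 0.
  have /(congr1 (fun m : 'rV_(\dim {:V}) => complex.Im (m 0 j))) := rxE.
  rewrite !mxE /= mulr0 add0r mulNr => /eqP.
  rewrite eq_sym oppr_eq0 mulf_eq0 => /orP[/eqP//|rv]; move: rj0.
  by rewrite !mxE rv.
apply/eigenvalueP; exists (rc v).
  by rewrite -/M -/toC rcM rxE /lamc s0 oppr0.
apply: contraNneq rv0 => rcv0; apply/eqP/rowP=> k.
have /(congr1 (fun m : 'rV_(\dim {:V}) => complex.Re (m 0 k))) := rcv0.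
by rewrite !mxE.
Qed.

End AngleSpaces.

(** * Good position *)

Section GoodPosition.

Local Open Scope classical_set_scope.
Local Open Scope ring_scope.
Variables (R : realType) (V : finNormedModType R) (ip : {dot V for idfun}).
Hypothesis ip_norm : forall v : V, `|v| ^+ 2 = ip v v.
Variables (gT : finGroupType) (W : {group gT}) (S : {set gT}) (delta : gT).
Hypothesis genS : <<S>>%g = W.
Hypothesis S2 : {in S, forall s, #[s]%g = 2%N}.
Hypothesis twist : twisted_by_delta W S delta.
Variable rho : gT -> 'End(V).
Hypothesis rho_rep : orthogonal_rep ip rho.
Hypothesis rho_refl : forall s : gT, s \in S -> is_reflection ip (rho s).
Variable C : set V.
Hypothesis fundC : fundamental_chamber ip rho W S delta C.
Variable c0 : V.
Hypothesis Cc0 : C c0.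
Variables (x : gT) (theta : seq R).

Local Notation T := (reflections ip W rho).
Local Notation root := (root ip rho c0).
Local Notation inv := (inv ip W rho c0).
Local Notation angle i := (nth 0 theta i).
Local Notation E t := (angle_space rho x t).
Local Notation d := #[x]%g.

Definition perp_angle t r : bool := (E t <= orthov ip <[root r]>)%VS.

Hypothesis sorted_theta : sorted <%R theta.
Hypothesis theta_range : forall t, t \in theta -> 0 <= t <= pi.
Hypothesis theta_eigen : forall t v, 0 <= t <= pi -> v \in E t -> v != 0 ->
  t \in theta.
(** Good position in terms of positive roots; [good_position_vector] derives it from chambers and
    regular points. *)
Hypothesis theta_good : forall i, (i < size theta)%N -> exists2 v, v \in E (angle i) &
  {in T, forall r, (forall j, (j < i)%N -> perp_angle (angle j) r) ->
    ~~ perp_angle (angle i) r -> 0 < ip v (root r)}.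
Implicit Types (r g w : gT) (t : R) (i j k : nat) (u v c : V).

Let invM := mem_invM ip_norm twist rho_rep fundC Cc0.
Let invS := inv_simple ip_norm genS twist rho_rep rho_refl fundC Cc0.
Let invd := inv_delta ip_norm fundC Cc0.
Let TJ := reflectionsJ twist rho_rep.
Let ipR := ip_rho_root ip_norm twist rho_rep fundC Cc0.

Lemma perp_angleP t r :
  reflect (forall v, v \in E t -> ip v (root r) = 0) (perp_angle t r).
Proof.
apply: (iffP subvP) => [sub v /sub | sub v /sub vr].
  by rewrite mem_orth_line => /eqP.
by rewrite mem_orth_line vr.
Qed.

Lemma perp_angleJ t g r : r \in T -> {in E t, forall v, rho g v \in E t} ->
  {in E t, forall v, rho g^-1%g v \in E t} ->
  perp_angle t (r ^ g)%g = perp_angle t r.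
Proof.
move=> rT gE gVE; apply/perp_angleP/perp_angleP => pr v vE.
  by rewrite -(rhoVK rho_rep g v) ipR // pr ?mulr0 // gVE.
have := ipR g v rT; rewrite pr ?gE // => /esym/eqP.
by rewrite mulf_eq0 signr_eq0 => /eqP.
Qed.

Lemma perp_angleX t k r : r \in T ->
  perp_angle t (r ^ (x ^+ k))%g = perp_angle t r.
Proof.
move=> rT; apply: perp_angleJ => // v.
  exact: (angle_spaceX rho_rep).
exact: (angle_spaceXV rho_rep).
Qed.

Lemma d_gt0 : 0 < d%:R :> R. Proof. by rewrite ltr0n order_gt0. Qed.

Lemma acos_cos_range (a : R) : 0 <= acos (cos a) <= pi.
Proof. by rewrite acos_ge0 ?acos_lepi // cos_geN1 cos_le1. Qed.

(* Fourier inversion over the cyclic group generated by [x]. *)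
Lemma exists_not_perp r : r \in T -> exists2 t, t \in theta & ~~ perp_angle t r.
Proof.
move=> rT; apply/hasP; rewrite has_predC; apply/negP=> /allP perp.
have [[rr _] _] := rootP ip_norm fundC Cc0 rT.
pose psi l : R := l%:R * (2 * pi) / d%:R.
have four0 l : ip (fourier rho x (root r) (psi l) 0) (root r) = 0.
  set v := fourier _ _ _ _ _; have [->|v0] := eqVneq v 0; first by rewrite ip0l.
  have vE : v \in E (psi l).
    apply: (fourier_angle_space rho_rep _ _ (l := l)).
    by rewrite /psi mulrC divfK // gt_eqF // d_gt0.
  (* [psi l] may exceed [pi]; the angle in [[0, pi]] with the same cosine has the same angle
     space. *)
  have vE' : v \in E (acos (cos (psi l))).
    move: vE; rewrite !mem_angle_space acosK //.
    by rewrite in_itv /= cos_geN1 cos_le1.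
  have th := theta_eigen (acos_cos_range _) vE' v0.
  exact: (perp_angleP _ _ (perp _ th)) vE'.
have : \sum_(l < d) ip (fourier rho x (root r) (psi l) 0) (root r) = 0.
  by rewrite big1.
under eq_bigr => l _.
  rewrite ip_suml; under eq_bigr => k _ do rewrite ipZl addr0; over.
rewrite exchange_big /= (bigD1 (Ordinal (order_gt0 x))) //= [X in _ + X]big1.
  under eq_bigr => l _ do rewrite mul0r cos0 mul1r expg0 (rho1 rho_rep) rr.
  rewrite sumr_const card_ord addr0 => /eqP.
  by rewrite pnatr_eq0 eqn0Ngt order_gt0.
move=> k k0; rewrite -mulr_suml.
have kd : (0 < k < d)%N by rewrite ltn_ord andbT lt0n.
under eq_bigr => l _.
  have -> : k%:R * psi l = l%:R * (k%:R * (2 * pi) / d%:R) by rewrite /psi; ring.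
  over.
by rewrite (sum_cos_period _ kd) mul0r.
Qed.

(** The index of the angle space that decides the sign on [root r]. *)
Definition type r : nat := find (fun t => ~~ perp_angle t r) theta.

Lemma type_lt r : r \in T -> (type r < size theta)%N.
Proof.
by move=> rT; rewrite -has_find; apply/hasP; apply: exists_not_perp.
Qed.

Lemma type_notperp r : r \in T -> ~~ perp_angle (angle (type r)) r.
Proof.
move=> rT; apply: (nth_find 0 (a := fun t => ~~ perp_angle t r)).
by rewrite has_find type_lt.
Qed.

Lemma type_perp r j : (j < type r)%N -> perp_angle (angle j) r.
Proof. by move=> /(before_find 0)/negbFE. Qed.

Lemma angle_range i : (i < size theta)%N -> 0 <= angle i <= pi.
Proof. by move=> i_lt; apply: theta_range; rewrite mem_nth. Qed.

(** [u] is the quarter turn of [v], and [x^d] turns [v] by [m] full turns. The last clause is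
    conditional because [v] may be 0, in which case no reflection has type [i]. *)
Definition good_datum i (v u : V) (m : nat) : Prop :=
  [/\ v \in E (angle i), u \in E (angle i),
      forall k, rho (x ^+ k)%g v =
                cos (k%:R * angle i) *: v + sin (k%:R * angle i) *: u,
      {in T, forall r, (forall j, (j < i)%N -> perp_angle (angle j) r) ->
         ~~ perp_angle (angle i) r -> 0 < ip v (root r)} &
      v != 0 -> d%:R * angle i = m%:R * (2 * pi)].

Lemma exists_good_data : exists (v u : nat -> V) (m : nat -> nat),
  forall i, (i < size theta)%N -> good_datum i (v i) (u i) (m i).
Proof.
have datum i : exists p : V * V * nat, (i < size theta)%N ->
    good_datum i p.1.1 p.1.2 p.2.
  case: (ltnP i (size theta)) => i_lt; last by exists (0, 0, 0%N).
  have [v vE vpos] := theta_good i_lt.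
  have [u [uE _ rotE]] := angle_rotation ip_norm rho_rep vE.
  have /andP[t0 _] := angle_range i_lt.
  have [v0|v0] := eqVneq v 0.
    by exists (v, u, 0%N) => _; split=> //=; rewrite v0 eqxx.
  have [m mE] := angle_period ip_norm rho_rep vE v0 t0.
  by exists (v, u, m) => _; split.
have [f fP] := choice datum.
by exists (fun i => (f i).1.1), (fun i => (f i).1.2), (fun i => (f i).2).
Qed.

(** * The sinusoid of a reflection, and chambers with prescribed angles *)

Section Waves.

Variables (vs us : nat -> V) (ms : nat -> nat).
Hypothesis data : forall i, (i < size theta)%N ->
  good_datum i (vs i) (us i) (ms i).

Definition wave r : R -> R :=
  sinusoid (ip (vs (type r)) (root r)) (ip (us (type r)) (root r)).

Lemma v_pos r : r \in T -> 0 < ip (vs (type r)) (root r).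
Proof.
move=> rT; have [_ _ _ pos _] := data (type_lt rT).
by apply: pos => // [j|]; [apply: type_perp|apply: type_notperp].
Qed.

Lemma angle_typeE r : r \in T ->
  d%:R * angle (type r) = (ms (type r))%:R * (2 * pi).
Proof.
move=> rT; have [_ _ _ _] := data (type_lt rT); apply.
by apply/eqP=> v0; have := v_pos rT; rewrite v0 ip0l ltxx.
Qed.

Lemma typeX r k : r \in T -> type (r ^ (x ^+ k))%g = type r.
Proof. by move=> rT; apply: eq_find => t; rewrite perp_angleX. Qed.

Lemma waveXE r k : r \in T -> wave r (k%:R * angle (type r)) =
  (-1) ^+ (r \in inv (x ^+ k)%g) * ip (vs (type r)) (root (r ^ (x ^+ k))%g).
Proof.
move=> rT; have [_ _ rotE _ _] := data (type_lt rT).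
by rewrite -ipR // rotE ipDl !ipZl /wave /sinusoid !(mulrC (ip _ _)).
Qed.

Lemma waveX_neq0 r k : r \in T -> wave r (k%:R * angle (type r)) != 0.
Proof.
move=> rT; rewrite waveXE // mulf_neq0 ?signr_eq0 // -{1}(typeX k rT).
by rewrite gt_eqF // v_pos // TJ.
Qed.

(** [r ^ (x ^+ k)] has the type of [r], so the same vector is positive on its root, and only the
    sign from [x ^+ k] remains. *)
Lemma waveX_lt0 r k : r \in T ->
  (wave r (k%:R * angle (type r)) < 0) = (r \in inv (x ^+ k)%g).
Proof.
move=> rT; have rkT : (r ^ (x ^+ k))%g \in T by rewrite TJ.
have := v_pos rkT; rewrite typeX // => pos.
by rewrite waveXE // signM_lt0 ?gt_eqF // [_ < 0]ltNge ltW // addbF.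
Qed.

Lemma wave_npi_neq0 r n : r \in T -> wave r (n%:R * pi) != 0.
Proof.
move=> rT; rewrite /wave sinusoid_npi.
by case: (odd n); rewrite ?oppr_eq0 gt_eqF // v_pos.
Qed.

Lemma wave_npi_lt0 r n : r \in T -> (wave r (n%:R * pi) < 0) = odd n.
Proof.
move=> rT; rewrite /wave sinusoid_npi; have := v_pos rT.
case: (odd n) => pos; first by rewrite oppr_lt0.
by rewrite ltNge ltW.
Qed.

(** Turn each [vs i] by [p i] and combine the results lexicographically: on [root r] the first
    nonzero term is that of index [type r]. The chamber of the resulting vector gives [w]. *)
Lemma realize_angles (p : nat -> R) :
  {in T, forall r, wave r (p (type r)) != 0} ->
  exists2 w, w \in W & {in T, forall r, (r \in inv w) = (wave r (p (type r)) < 0)}.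
Proof.
move=> p0; pose y i := cos (p i) *: vs i + sin (p i) *: us i.
have yE i : (i < size theta)%N -> y i \in E (angle i).
  by move=> /data[vE uE _ _ _]; rewrite memvD // memvZ.
have ywave r : ip (y (type r)) (root r) = wave r (p (type r)).
  by rewrite ipDl !ipZl /wave /sinusoid !(mulrC (ip _ _)).
have [v vP] := lexicographic_vector ip root y (size theta).
have sgE r : r \in T -> Num.sg (ip v (root r)) = Num.sg (wave r (p (type r))).
  move=> rT; rewrite -ywave; apply: vP; rewrite ?type_lt // ?ywave ?p0 //.
  move=> k kr; apply: (perp_angleP _ _ (type_perp kr)); apply: yE.
  exact: ltn_trans kr (type_lt rT).
have gv : generic ip W rho c0 v.
  by move=> r rT; rewrite -sgr_eq0 sgE // sgr_eq0 p0.
have [w wW wE] := realize_signs ip_norm twist rho_rep fundC Cc0 gv.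
exists w => // r rT; rewrite wE // -sgr_lt0 sgE //.
by rewrite sgr_lt0.
Qed.

(** Twice this number is the width of the grid. The successor keeps the product of squares nonempty,
    as in [good_element]. *)
Definition half_turns : nat := (\max_(r in T) ms (type r)).+1.

Lemma ms_lt r : r \in T -> (ms (type r) < half_turns)%N.
Proof. by move=> rT; rewrite ltnS (bigD1 r) //= leq_maxl. Qed.

(** Rows are powers of [x] and columns are half turns; the cap [2 * ms i] half turns is the total
    angle of [x^d] on the spaces that carry a reflection type. *)
Definition grid_angle k j i : R :=
  Num.min (k%:R * angle i) ((minn j (2 * ms i))%:R * pi).

Lemma grid_wave_neq0 r k j : r \in T -> wave r (grid_angle k j (type r)) != 0.
Proof.
move=> rT; rewrite /grid_angle minEle; case: ifP => _.
  exact: waveX_neq0.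
exact: wave_npi_neq0.
Qed.

Lemma exists_grid : exists g : nat -> nat -> gT, forall k j, g k j \in W /\
  {in T, forall r, (r \in inv (g k j)) = (wave r (grid_angle k j (type r)) < 0)}.
Proof.
have ex (kj : nat * nat) : exists w, w \in W /\ {in T, forall r,
    (r \in inv w) = (wave r (grid_angle kj.1 kj.2 (type r)) < 0)}.
  have [|w wW wE] := realize_angles (p := grid_angle kj.1 kj.2).
    by move=> r rT; apply: grid_wave_neq0.
  by exists w.
by have [g gP] := choice ex; exists (fun k j => g (k, j)) => k j; apply: gP (k, j).
Qed.

Definition high_reflections a : {set gT} :=
  finset (fun r => (r \in T) && (a < ms (type r))%N).

(** As the angles increase, the set consists of the reflections whose hyperplanes contain a fixed
    sum of angle spaces, as for a parabolic subgroup. *)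
Lemma high_reflectionsP a r : reflect
  (r \in T /\ forall t, t \in theta -> d%:R * t <= a%:R * (2 * pi) -> perp_angle t r)
  (r \in high_reflections a).
Proof.
have pi2 : 0 < 2 * pi :> R by rewrite mulr_gt0 ?pi_gt0.
rewrite [r \in high_reflections a]finset.in_set; apply: (iffP andP) => -[rT].
  move=> a_lt; split=> // t /(nthP 0)[j j_lt <-] t_le; apply: type_perp.
  rewrite -(lt_sorted_ltn_nth 0 sorted_theta) ?inE ?type_lt //.
  rewrite -(ltr_pM2l d_gt0) (le_lt_trans t_le) // angle_typeE //.
  by rewrite ltr_pM2r // ltr_nat.
move=> perp; split=> //; rewrite ltnNge; apply: contra (type_notperp rT) => ms_le.
apply: perp; first by rewrite mem_nth // type_lt.
by rewrite angle_typeE // ler_pM2r // ler_nat.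
Qed.

Lemma high_simple_fixed a s t v : s \in S :&: high_reflections a ->
  t \in theta -> d%:R * t <= a%:R * (2 * pi) -> v \in E t -> rho s v = v.
Proof.
rewrite finset.in_setI => /andP[sS /high_reflectionsP[sT perp]] th t_le vE.
have [[_ ->] _] := rootP ip_norm fundC Cc0 sT.
by rewrite /refl (perp_angleP _ _ (perp t th t_le)) // mulr0 scale0r subr0.
Qed.

Lemma high_stable a s r : s \in S :&: high_reflections a ->
  r \in high_reflections a -> (r ^ s)%g \in high_reflections a.
Proof.
move=> sJ /high_reflectionsP[rT perp]; apply/high_reflectionsP.
rewrite TJ; split=> // t th t_le; have sV : s^-1%g = s.
  by apply: (simpleV S2); move: sJ; rewrite finset.in_setI => /andP[].
rewrite perp_angleJ ?sV ?perp // => v vE;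
  by rewrite (high_simple_fixed sJ th t_le vE).
Qed.

(** [w] fixes all angle spaces of at most [a] full turns. If [ms (type r) <= a], then [r ^ w] is
    perpendicular to the same spaces up to index [type r], so the fixed vector [vs (type r)] is
    positive on the roots of both [r] and [r ^ w]; thus [r] is not inverted. *)
Lemma high_parabolic a w : w \in <<S :&: high_reflections a>>%g ->
  inv w \subset high_reflections a.
Proof.
move=> wJ.
have fixed t v : t \in theta -> d%:R * t <= a%:R * (2 * pi) -> v \in E t ->
    rho w v = v.
  move=> th t_le vE; have [c cJ <-] := gen_S_word wJ.
  elim: c cJ => [|s c IHc]; first by rewrite word_prod_nil (rho1 rho_rep).
  rewrite S_word_cons word_prod_cons (rhoM rho_rep) => /andP[sJ /IHc->].
  exact: high_simple_fixed sJ th t_le vE.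
apply/fintype.subsetP=> r rw; have rT := inv_sub rw.
apply: contraLR rw; rewrite finset.in_set rT /= -leqNgt => ms_le.
have th_le j : (j <= type r)%N -> d%:R * angle j <= a%:R * (2 * pi).
  have pi2 : 0 < 2 * pi :> R by rewrite mulr_gt0 ?pi_gt0.
  move=> j_le; apply: (@le_trans _ _ (d%:R * angle (type r))).
    rewrite ler_pM2l ?d_gt0 // (lt_sorted_leq_nth 0 sorted_theta) //.
      by rewrite inE (leq_ltn_trans j_le) // type_lt.
    by rewrite inE type_lt.
  by rewrite angle_typeE // ler_pM2r // ler_nat.
have fix_j j v : (j <= type r)%N -> v \in E (angle j) -> rho w v = v.
  move=> j_le; apply: fixed; last exact: th_le.
  by rewrite mem_nth // (leq_ltn_trans j_le) // type_lt.
have perp_j j : (j <= type r)%N ->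
    perp_angle (angle j) (r ^ w)%g = perp_angle (angle j) r.
  move=> j_le; apply: perp_angleJ => // v vE; first by rewrite (fix_j j).
  by rewrite -{1}(fix_j j v) // (rhoK rho_rep).
have [vE _ _ pos _] := data (type_lt rT).
have := ipR w (vs (type r)) rT; rewrite (fix_j (type r)) //.
have pw : 0 < ip (vs (type r)) (root (r ^ w)%g).
  apply: pos; first by rewrite TJ.
    by move=> j jr; rewrite perp_j ?type_perp // ltnW.
  by rewrite perp_j ?type_notperp.
case: (r \in inv w) => //=; rewrite mulN1r => vr.
by have := v_pos rT; rewrite vr oppr_gt0 ltNge ltW.
Qed.

(** * The grid of chambers and the power of [x] *)

Lemma grid_angle_le k k' j j' i : (k <= k')%N -> (j <= j')%N ->
  (i < size theta)%N -> grid_angle k j i <= grid_angle k' j' i.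
Proof.
move=> kk jj /angle_range/andP[t0 _]; rewrite /grid_angle le_min !ge_min.
rewrite ler_wpM2r ?ler_nat //= ler_wpM2r ?pi_ge0 ?orbT // ler_nat.
by rewrite leq_min geq_minr andbT geq_min jj.
Qed.

Lemma grid_angle_step k j i : (i < size theta)%N ->
  grid_angle k.+1 j.+1 i <= grid_angle k j i + pi.
Proof.
move=> /angle_range/andP[t0 tpi]; rewrite /grid_angle.
have k1 : k.+1%:R * angle i <= k%:R * angle i + pi.
  by rewrite -natr1 mulrDl mul1r lerD2l.
have j1 : (minn j.+1 (2 * ms i))%:R * pi <= (minn j (2 * ms i))%:R * pi + pi :> R.
  rewrite -[X in _ + X]mul1r -mulrDl natr1 ler_wpM2r ?pi_ge0 // ler_nat.
  by rewrite -minnSS leq_min geq_minl (leq_trans (geq_minr _ _)).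
by rewrite [X in _ <= X + _]minEle; case: ifP => _; rewrite ge_min ?k1 ?j1 ?orbT.
Qed.

Definition grid_sign r k j : bool := wave r (grid_angle k j (type r)) < 0.

(** Along a monotone path in a unit square the angles increase by at most [pi] in total, because
    [angle i <= pi]. *)
Lemma grid_wave_no_return r (k1 k2 k3 j1 j2 j3 k j : nat) : r \in T ->
  (k <= k1 <= k2)%N -> (k2 <= k3 <= k.+1)%N -> (j <= j1 <= j2)%N ->
  (j2 <= j3 <= j.+1)%N ->
  ~~ ((grid_sign r k1 j1 (+) grid_sign r k2 j2) &&
      (grid_sign r k2 j2 (+) grid_sign r k3 j3)).
Proof.
move=> rT /andP[k01 k12] /andP[k23 k3S] /andP[j01 j12] /andP[j23 j3S].
have i_lt := type_lt rT; rewrite /grid_sign.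
apply: sinusoid_no_return; try exact: grid_wave_neq0; try exact: grid_angle_le.
apply: le_trans (grid_angle_le k3S j3S i_lt) _.
apply: le_trans (grid_angle_step k j i_lt) _.
by rewrite lerD2r grid_angle_le.
Qed.

Lemma size_tbraid_exp (b : tbraid gT) n :
  size (tbraid_exp b n).2 = (n * size b.2)%N.
Proof.
elim: n => // n IHn.
by rewrite /tbraid_exp iterS -/(tbraid_exp b n) /= size_cat size_map IHn mulSn.
Qed.

Lemma size_tbraid_prod n (b : nat -> tbraid gT) :
  size (\big[@tbraid_mul gT/@tbraid1 gT]_(i < n) b i).2
    = (\sum_(i < n) size (b i).2)%N.
Proof.
elim: n => [|n IHn]; first by rewrite !big_ord0.
by rewrite !big_ord_recr /= size_cat size_map IHn.
Qed.

Lemma invW_empty w : w \in W -> {in T, forall r, r \notin inv w} -> w = 1%g.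
Proof.
move=> wW w0; apply: (inv_inj1 genS S2 invM invS wW).
apply/finset.setP=> r; rewrite finset.in_set0; apply/negbTE/negP=> rw.
by have := w0 r (inv_sub rw); rewrite rw.
Qed.

Lemma lift1 : tbraid_lift W S delta 1%g = @tbraid1 gT.
Proof.
rewrite (tbraid_lift_W twist) // /tbraid1; congr (_, _).
have [_ _ sz] := reduced_wordP genS S2 invM invS (group1 W).
by apply: size0nil; rewrite sz (inv1 invM) cards0.
Qed.

Lemma good_power : exists z : nat -> gT,
  (forall a, (a < half_turns)%N -> z a \in W /\ inv (z a) = high_reflections a) /\
  tbraid_eq S (tbraid_exp (tbraid_lift W S delta x) d)
    (\big[@tbraid_mul gT/@tbraid1 gT]_(a < half_turns)
       tbraid_exp (tbraid_lift W S delta (z a)) 2).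
Proof.
have [g gP] := exists_grid; set K := half_turns; set N := (2 * K)%N.
(* The last column takes [x ^+ k] itself: it has the inversions of [g k N], but its part in
   [<[delta]>] may be nontrivial. *)
pose h k j := if j == N then (x ^+ k)%g else g k j.
have N0 : (0 < N)%N by [].
have inv_h k j r : (k <= d)%N -> (j <= N)%N -> r \in T ->
    (r \in inv (h k j)) = grid_sign r k j.
  move=> k_le j_le rT; rewrite /h; case: eqP => [->|_]; last first.
    by have [_ ->] := gP k j.
  rewrite -waveX_lt0 // /grid_sign /grid_angle (minn_idPr _); last first.
    by rewrite leq_mul2l ltnW // ms_lt.
  have msE : (2 * ms (type r))%:R * pi = d%:R * angle (type r) :> R.
    by rewrite angle_typeE // natrM; ring.
  rewrite min_l // msE ler_wpM2r ?ler_nat //.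
  by have /andP[] := angle_range (type_lt rT).
have sq k j : (k < d)%N -> (j < N)%N -> let sq := ((h k j)^-1 * h k.+1 j.+1)%g in
     [/\ #|inv sq| = (#|inv ((h k j)^-1 * h k j.+1)%g|
                     + #|inv ((h k j.+1)^-1 * h k.+1 j.+1)%g|)%N
       & #|inv sq| = (#|inv ((h k j)^-1 * h k.+1 j)%g|
                     + #|inv ((h k.+1 j)^-1 * h k.+1 j.+1)%g|)%N].
  move=> k_lt j_lt /=; split; apply: (card_inv_sum invM) => r;
    (case: (boolP (r \in T)) => rT; last first).
  - by rewrite !(contraNF (@inv_sub _ _ _ _ _ _ _ _ r)).
  - rewrite !inv_h //; try exact: ltnW.
    by apply: (grid_wave_no_return (k := k) (j := j)); rewrite ?leqnn ?leqnSn.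
  - by rewrite !(contraNF (@inv_sub _ _ _ _ _ _ _ _ r)).
  - rewrite !inv_h //; try exact: ltnW.
    by apply: (grid_wave_no_return (k := k) (j := j)); rewrite ?leqnn ?leqnSn.
have := grid_chain genS S2 twist invM invS invd sq.
have angle0 r : r \in T -> wave r 0 < 0 = false.
  by move=> rT; have := wave_npi_lt0 0 rT; rewrite mul0r.
(* The first column and the first row are at angle 0, so these two sides of the grid are trivial. *)
have h0 k : (k <= d)%N -> h k 0%N = 1%g.
  move=> k_le; have -> : h k 0%N = g k 0%N by rewrite /h; case: eqP.
  have [gW gE] := gP k 0%N; apply: invW_empty => // r rT.
  rewrite gE // /grid_sign /grid_angle min0n mul0r min_r ?angle0 //.
  rewrite mulr_ge0 //; by have /andP[] := angle_range (type_lt rT).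
have h0j j : (j <= N)%N -> h 0%N j = 1%g.
  rewrite /h; case: eqP => [_ _|_ j_le]; first by rewrite expg0.
  have [gW gE] := gP 0%N j; apply: invW_empty => // r rT.
  by rewrite gE // /grid_sign /grid_angle mul0r min_l ?angle0 // mulr_ge0 ?pi_ge0.
have angle_d r j : r \in T ->
    grid_angle d j (type r) = (minn j (2 * ms (type r)))%:R * pi.
  move=> rT; rewrite /grid_angle min_r // angle_typeE // mulrA -natrM.
  by rewrite ler_wpM2r ?pi_ge0 // ler_nat mulnC geq_minr.
have inv_hd j r : (j <= N)%N -> r \in T ->
    (r \in inv (h d j)) = odd (minn j (2 * ms (type r))).
  by move=> j_le rT; rewrite inv_h // /grid_sign angle_d // wave_npi_lt0.
have hdW j : h d j \in W.
  rewrite /h; case: eqP => _; first by rewrite expg_order group1.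
  by have [] := gP d j.
(* On the last row all angles are multiples of [pi]: even columns are back at [C], and column
   [2 a + 1] inverts the [r] with [a < ms (type r)], the others having stopped after an even number
   of half turns. *)
have hd_even a : (a <= K)%N -> h d (2 * a)%N = 1%g.
  move=> a_le; apply: invW_empty => // r rT.
  rewrite inv_hd ?leq_mul2l // -minnMr oddM //.
pose z a := h d (2 * a).+1.
have zE a : (a < K)%N -> inv (z a) = high_reflections a.
  move=> a_lt; apply/finset.setP=> r; rewrite [in RHS]finset.in_set.
  have zN : ((2 * a).+1 <= N)%N by rewrite /N; lia.
  case: (boolP (r \in T)) => rT; last by rewrite (contraNF (@inv_sub _ _ _ _ _ _ _ _ r)).
  by rewrite /z inv_hd //=; lia.
have z2 a : (a < K)%N -> ((z a)^-1 = z a)%g.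
  move=> a_lt; apply: (parabolic_involution genS S2 invM invS (hdW _) (zE a a_lt)).
    exact: high_stable.
  exact: high_parabolic.
(* The steps from 1 to [z a] and back contribute the lifts of [z a] and of its inverse, again
   [z a]. *)
have chain_d n : (n <= K)%N -> chain W S delta (h d) (2 * n)%N =
    \big[@tbraid_mul gT/@tbraid1 gT]_(a < n)
       tbraid_exp (tbraid_lift W S delta (z a)) 2.
  elim: n => [|n IHn] n_le; first by rewrite muln0 /chain !big_ord0.
  rewrite mulnS /chain !big_ord_recr /= -/(chain _ _ _ _ _) IHn 1?ltnW //.
  rewrite tbraid_mulb1 -tbraid_mulA hd_even 1?ltnW // invg1 mul1g -/(z n).
  have -> : (2 * n).+2 = (2 * n.+1)%N by rewrite mulnS.
  by rewrite hd_even // mulg1 z2.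
have chain1 f n : (forall i, (i <= n)%N -> f i = 1%g) ->
    chain W S delta f n = @tbraid1 gT.
  move=> f1; rewrite /chain big1 // => i _.
  by rewrite !f1 ?invg1 ?mulg1 ?lift1 // ltnW.
rewrite chain_d // [chain _ _ _ (fun i => h i 0%N) _]chain1 //.
rewrite [chain _ _ _ (h 0%N) _]chain1 // !tbraid_mul1b.
have -> : chain W S delta (fun i => h i N) d =
    tbraid_exp (tbraid_lift W S delta x) d.
  rewrite tbraid_exp_big /chain; apply: eq_bigr => i _.
  by rewrite /h eqxx expgSr mulKg.
move=> /tbraid_eq_sym pE; exists z; split=> // a a_lt.
by split; [apply: hdW|apply: zE].
Qed.

Lemma good_element_of_data : good_element W S delta x.
Proof.
have [z [zP zE]] := good_power.
pose J a := S :&: high_reflections a.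
have JE a : (a < half_turns)%N -> longest S (J a) = z a.
  move=> /zP[zW invz]; apply: (longest_parabolic genS S2 invM invS zW invz).
    exact: high_stable.
  exact: high_parabolic.
have subJ a : J a.+1 \subset J a.
  apply/fintype.subsetP=> r; rewrite !finset.inE => /and3P[-> -> /=].
  exact: ltnW.
have [l [K [e [_ KJ Kproper e_even bigE]]]] :=
  @compress_longest gT W S delta J (\max_(r in T) ms (type r))%N subJ.
exists l, K, e; split=> //.
  by move=> i _; have [a ->] := KJ i; apply: subsetIl.
rewrite -bigE; apply: (tbraid_eq_trans zE).
rewrite (eq_bigr (fun a : 'I_half_turns =>
  tbraid_exp (tbraid_lift W S delta (longest S (J a))) 2)).
  exact: tbraid_eq_refl.
by move=> a _; rewrite JE.
Qed.

(** Braid relations preserve the number of letters, so both sides of [good_power] have equal size;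
    [r] lies in the high reflections for exactly [ms (type r)] values of [a]. *)
Lemma length_of_data :
  (d * #|inv x| = 2 * \sum_(r in T) ms (type r))%N.
Proof.
have sizeL := size_lift genS S2 twist invM invS invd.
have [z [zP /tbraid_eq_size]] := good_power.
rewrite size_tbraid_exp sizeL => ->.
rewrite (size_tbraid_prod _ (fun a => tbraid_exp (tbraid_lift W S delta (z a)) 2)).
transitivity (\sum_(a < half_turns) 2 * \sum_(r in T) (a < ms (type r)))%N.
  apply: eq_bigr => a _; have [_ zE] := zP a (ltn_ord a).
  rewrite size_tbraid_exp sizeL zE; congr (2 * _)%N.
  rewrite -sum1_card [RHS]big_mkcond [LHS]big_mkcond /=; apply: eq_bigr => r _.
  by rewrite finset.in_set; case: (r \in T); case: (_ < _)%N.
rewrite -big_distrr exchange_big /=; congr (2 * _)%N; apply: eq_bigr => r rT.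
have := ms_lt rT; move: (ms _) half_turns => m K m_lt.
rewrite -(big_mkord xpredT (fun a => nat_of_bool (a < m)%N)).
rewrite (big_cat_nat (n := m)) //=; last exact: ltnW.
rewrite big_nat_cond (eq_bigr (fun=> 1%N)); last by move=> i /andP[/andP[_ ->]].
rewrite -big_nat_cond sum_nat_const_nat subn0 muln1 big_nat_cond big1 ?addn0 //.
by move=> i /andP[/andP[mi _] _]; rewrite ltnNge mi.
Qed.

Lemma card_inv_VM p q :
  #|inv (p^-1 * q)%g| = (\sum_(r in T) ((r \in inv p) (+) (r \in inv q)))%N.
Proof.
rewrite -sum1_card [LHS]big_mkcond [RHS]big_mkcond /=.
rewrite [RHS](reindex_inj (@conjg_inj _ p^-1%g)) /=; apply: eq_bigr => r _.
rewrite (mem_invVM invM) TJ.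
case: (boolP (r \in T)) => rT; first by case: (_ (+) _).
by rewrite !(contraNF (@inv_sub _ _ _ _ _ _ _ _ (r ^ p^-1)%g)) // TJ.
Qed.

(** A Fourier coefficient of frequency below [ms (type r)] lies in an angle space of index less than
    [type r], hence in the hyperplane of [r]; the bound on sign changes applies. *)
Lemma sign_changes_orbit c r : generic ip W rho c0 c -> r \in T ->
  (2 * ms (type r) <= \sum_(k < d)
    ((ip (rho (x ^+ k)%g c) (root r) < 0)%R (+)
     (ip (rho (x ^+ k.+1)%g c) (root r) < 0)%R))%N.
Proof.
move=> gc rT; apply: (@sign_changes_ge _ (fun k => ip (rho (x ^+ k)%g c) (root r))).
- by move=> k; apply: (genericM ip_norm twist rho_rep fundC Cc0).
- by rewrite expg_order expg0.
- exact: order_gt0.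
move=> l phi l_lt; pose psi : R := l%:R * (2 * pi / d%:R).
have dpsi : d%:R * psi = l%:R * (2 * pi).
  by rewrite /psi mulrCA [d%:R * _]mulrC divfK // gt_eqF // d_gt0.
transitivity (ip (fourier rho x c psi phi) (root r)).
  by rewrite ip_suml; apply: eq_bigr => k _; rewrite ipZl.
set v := fourier _ _ _ _ _; have [->|v0] := eqVneq v 0; first by rewrite ip0l.
have vE : v \in E psi := fourier_angle_space rho_rep c phi dpsi.
have psi_lt : psi < angle (type r).
  rewrite -(ltr_pM2l d_gt0) dpsi angle_typeE // ltr_pM2r ?ltr_nat //.
  by rewrite mulr_gt0 ?pi_gt0.
have psi0 : 0 <= psi by rewrite mulr_ge0 // divr_ge0 // mulr_ge0 // pi_ge0.
have /andP[_ th_pi] := angle_range (type_lt rT).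
have := theta_eigen _ vE v0; rewrite psi0 (le_trans (ltW psi_lt) th_pi).
move=> /(_ isT)/(nthP 0)[j j_lt jE]; rewrite -jE in psi_lt vE.
apply: (perp_angleP _ _ (type_perp _)) vE.
by rewrite -(lt_sorted_ltn_nth 0 sorted_theta) ?inE ?type_lt.
Qed.

(** [d] times the length of [y = x ^ g] counts the crossings along the orbit of [C] under [y].
    Conjugation by [g] turns it into the orbit of [rho g c0] under [x]. *)
Lemma length_conj_ge g :
  (2 * \sum_(r in T) ms (type r) <= d * #|inv (x ^ g)%g|)%N.
Proof.
pose y := (x ^ g)%g; have gc0 := genericM ip_norm twist rho_rep fundC Cc0 g
  (generic_c0 ip_norm fundC Cc0).
rewrite -/y (_ : d * #|inv y| = \sum_(r in T) \sum_(k < d)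
    ((r \in inv (y ^+ k)%g) (+) (r \in inv (y ^+ k.+1)%g)))%N; last first.
  rewrite exchange_big /= (eq_bigr (fun=> #|inv y|)); last first.
    by move=> k _; rewrite -card_inv_VM expgSr mulKg.
  by rewrite sum_nat_const card_ord.
rewrite big_distrr /= big_mkcond [X in (_ <= X)%N]big_mkcond /=.
rewrite [X in (_ <= X)%N](reindex_inj (@conjg_inj _ g)) /=.
apply: leq_sum => r _; rewrite TJ; case: ifP => // rT.
apply: leq_trans (sign_changes_orbit gc0 rT) _.
apply: leq_sum => k _; have signE j : ((r ^ g)%g \in inv (y ^+ j)%g) =
    ((r ^ g)%g \in inv g^-1%g) (+) (ip (rho (x ^+ j)%g (rho g c0)) (root r) < 0).
  rewrite mem_inv ?TJ // /y -conjXg conjgE !(rhoM rho_rep).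
  rewrite (ip_rho_root_lt0 ip_norm twist rho_rep fundC Cc0) ?TJ ?conjgK //.
  exact: (genericM ip_norm twist rho_rep fundC Cc0).
by rewrite !signE addbACA addbb.
Qed.

Lemma min_length_of_data : min_length_in_class W S delta x.
Proof.
move=> _ /imsetP[g _ ->].
rewrite !(tlenE genS S2 twist invM invS invd).
by rewrite -(leq_pmul2l (order_gt0 x)) length_of_data length_conj_ge.
Qed.

End Waves.

Theorem good_and_minimal :
  good_element W S delta x /\ min_length_in_class W S delta x.
Proof.
have [v [u [m data]]] := exists_good_data.
by split; [apply: good_element_of_data data|apply: min_length_of_data data].
Qed.

End GoodPosition.

(** * From chambers and regular points to roots, and from [A] to [C] *)

Local Open Scope classical_set_scope.
Local Open Scope ring_scope.

(** The regular point splits as [f + b] with [f] in the previous flag space and [b] in the i-th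
    angle space. The hyperplane in question contains [f], and the component [Ci] lies on the side of
    [A], so the value of [b] is nonnegative; regularity excludes 0, since the hyperplane does not
    contain the next flag space. *)
Lemma good_position_vector (R : realType) (V : finNormedModType R)
    (ip : {dot V for idfun}) (ip_norm : forall v : V, `|v| ^+ 2 = ip v v)
    (gT : finGroupType) (W : {group gT}) (rho : gT -> 'End(V))
    (x : gT) (theta : seq R) (A : set V) (a0 : V) (i : nat) :
  good_position ip rho W x theta A -> A a0 -> (i < size theta)%N ->
  exists2 v, v \in angle_space rho x (nth 0 theta i) &
    forall r b, r \in W -> is_root ip rho r b ->
      (forall j, (j < i)%N ->
        (angle_space rho x (nth 0%R theta j) <= orthov ip <[b]>)%VS) ->
      ~~ (angle_space rho x (nth 0%R theta i) <= orthov ip <[b]>)%VS ->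
      0 < ip a0 b -> 0 < ip v b.
Proof.
move=> good Aa0 i_lt; have [Ci [Ci_comp ACi [v Civ [vF vreg]]]] := good i i_lt.
have FS : angle_flag rho x theta i.+1 =
    (angle_flag rho x theta i + angle_space rho x (nth 0%R theta i))%VS.
  by rewrite /angle_flag (take_nth 0) // -cats1 big_cat big_seq1.
have [f fF [b bE vE]] : exists2 f, f \in angle_flag rho x theta i &
    exists2 b, b \in angle_space rho x (nth 0 theta i) & v = f + b.
  by apply/memv_addP; rewrite -FS.
exists b => // r c rW rc perp nperp a0c.
have Hc := root_hyperplane ip_norm rW rc.
have Fc : (angle_flag rho x theta i <= orthov ip <[c]>)%VS.
  have : forall t, t \in take i theta -> (angle_space rho x t <= orthov ip <[c]>)%VS.
    move=> t /(nthP 0)[j]; rewrite size_take i_lt => j_lt <-.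
    by rewrite nth_take // perp.
  rewrite /angle_flag; elim: (take i theta) => [|t s IHs] sub.
    by rewrite big_nil sub0v.
  rewrite big_cons subv_add sub ?mem_head //=; apply: IHs => t' t's.
  by rewrite sub // inE t's orbT.
have Ci0 w : Ci w -> ip w c != 0.
  case: Ci_comp => c1 _ ->; move/connected_component_sub => wH.
  apply/negP => wc; apply: wH; exists (orthov ip <[c]>%VS).
    by split=> // u uF; apply: (subvP Fc).
  by rewrite /= mem_orth_line.
have Cipos w : Ci w -> 0 < ip w c.
  move=> Ciw; apply: (connected_pos ip_norm _ Ci0 (ACi _ Aa0) Ciw a0c).
  by case: Ci_comp => c1 _ ->; apply: component_connected.
have v0 : 0 <= ip v c := closure_nneg ip_norm Cipos Civ.
have fc : ip f c = 0 by apply/eqP; rewrite -mem_orth_line (subvP Fc).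
suff vc : ip v c != 0.
  by have : 0 < ip v c by [rewrite lt_neqAle eq_sym vc]; rewrite vE ipDl fc add0r.
apply: contra nperp => vc; apply/subvP=> u uE.
apply: (vreg _ Hc); first by rewrite mem_orth_line.
by rewrite /= FS (subvP (addvSr _ _)).
Qed.

Theorem proposition5p3
  (gT : finGroupType) (W : {group gT}) (S : {set gT}) (delta : gT)
  (coxWS : coxeter_system W S) (twist : twisted_by_delta W S delta)
  (R : realType) (V : finNormedModType R) (ip : {dot V for idfun})
  (ip_norm : forall v : V, `|v| ^+ 2 = ip v v)
  (rho : gT -> 'End(V)) (rho_rep : orthogonal_rep ip rho)
  (rho_refl : forall s : gT, s \in S -> is_reflection ip (rho s))
  (C : set V) (fundC : fundamental_chamber ip rho W S delta C)
  (wt : gT) (theta : seq R) (thetaP : eigen_angles (rho wt) theta)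
  (A : set V) (chA : chamber ip rho W A)
  (xA : gT) (xAW : xA \in W) (xAP : rho xA @` C = A) :
  good_position ip rho W wt theta A ->
  good_element W S delta (wt ^ xA)%g /\
  min_length_in_class W S delta (wt ^ xA)%g.
Proof.
move=> good; have [genS S2 _] := coxWS; have [sorted_theta angleP] := thetaP.
have [c0 Cc0] : exists c0, C c0.
  have [[c Dc ->] _ _] := fundC.
  by exists c; apply: connected_component_refl.
apply: (good_and_minimal ip_norm genS S2 twist rho_rep rho_refl fundC Cc0
  sorted_theta).
- by move=> t /angleP[].
- move=> t v t_range vE v0; apply/angleP; split=> //.
  apply: (angle_eigenvalue rho_rep (v := rho xA v)).
    by rewrite (angle_spaceJ rho_rep).
  apply: contraNneq v0 => xv0.
  by rewrite -(rhoK rho_rep xA v) xv0 linear0.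
move=> i i_lt; have Axc : A (rho xA c0) by rewrite -xAP; exists c0.
have [v vE vpos] := good_position_vector ip_norm good Axc i_lt.
(* The vector is carried from [A] back to [C]. The root of [r] corresponds to the unit normal
   [rho xA (root r)] of [r ^ xA^-1], which is positive on [A]. *)
exists (rho xA^-1%g v); first by rewrite -(angle_spaceJ rho_rep) (rhoVK rho_rep).
move=> r rT perp nperp.
have [rr c0r] := rootP ip_norm fundC Cc0 rT.
have xr := is_rootJ rho_rep xA^-1%g rr; rewrite invgK in xr.
have xrW : (r ^ xA^-1)%g \in W.
  by have := reflectionsJ twist rho_rep r xA^-1%g; rewrite rT => /reflectionsP[].
have perpE t : (angle_space rho wt t <= orthov ip <[rho xA (root ip rho c0 r)]>)%VS
    = perp_angle ip rho c0 (wt ^ xA)%g t r.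
  apply/idP/idP=> /subvP sub; apply/subvP => u uE.
    have := sub (rho xA u); rewrite (angle_spaceJ rho_rep) => /(_ uE).
    by rewrite !mem_orth_line (ip_rho rho_rep) (rhoK rho_rep).
  have := sub (rho xA^-1%g u); rewrite -(angle_spaceJ rho_rep) (rhoVK rho_rep).
  by move=> /(_ uE); rewrite !mem_orth_line (ip_rho rho_rep) invgK.
rewrite (ip_rho rho_rep) invgK; apply: vpos xrW xr _ _ _.
- by move=> j j_lt; rewrite perpE perp.
- by rewrite perpE.
by rewrite (ip_rho rho_rep) (rhoK rho_rep).
Qed.
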